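(* Let $k\ge 2$ and $N\geq 3$ be integers, let $q>1$ and $p>\frac{N}{N-2}$ be real numbers, let $Q=(0,\infty)\times\mathbb{R}^N$, and consider the problem $$ (\mathrm{P})\qquad \partial_t^k u-\Delta u = |u|^p + |\partial^{k-1}_{t} u|^q+ w(t,x)\quad \text{in } Q. $$ Let $a^*=\frac{2p}{p-1}$, and for $a<N$ let $$ \mathbb{I}_a=\left\{g\in C(\mathbb{R}^N)\;\big|\; g(x)\geq 0,\ g(x)\geq C |x|^{-a} \text{ for } |x| \text{ large}\right\}, $$ $$ \mathbb{J}_a=\left\{g\in C(\mathbb{R}^N)\;\big|\; g(x)>0,\ g(x)\leq C |x|^{-a} \text{ for } |x| \text{ large}\right\}, $$ where $C>0$ is a constant (independent of $x$). (I) If $a<a^*$ and $w=g(x)\in \mathbb{I}_a$, then problem $(\mathrm{P})$ admits no weak solutions. (II) If $a^*\leq a<N$, then problem $(\mathrm{P})$ has positive global solutions for some $w=g(x)\in \mathbb{J}_a$ and suitable initial values.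
   Context: Here $\partial_t^i=\frac{\partial^i}{\partial t^i}$ and $\Delta$ is the Laplacian in $x\in\mathbb{R}^N$. $C_c^2(Q)$ denotes the space of $C^2$ real-valued functions compactly supported in $Q=(0,\infty)\times\mathbb{R}^N$. The constant $C>0$ in the definitions of $\mathbb{I}_a$ and $\mathbb{J}_a$ may depend on $g$ but not on $x$. Definition (weak solution). A pair $(u,\partial^{k-1}_{t} u)\in L^p_{loc}(Q)\times L^q_{loc}(Q)$ (the time derivative $\partial_t^{k-1}u$ being understood in the sense of distributions on $Q$) is a weak solution to $(\mathrm{P})$ if for every $\varphi\in C_c^2(Q)$, $$ \int_Q \left(|u|^p+|\partial^{k-1}_{t} u|^q+w(t,x)\right)\varphi\,dx\,dt =-\int_Q \partial^{k-1}_t u\,\partial_t \varphi\,dx\,dt-\int_Q u\, \Delta \varphi\,dx\,dt. $$ No conditions on initial values are imposed in this definition. A positive global solution is a solution $u>0$ defined on all of $Q$; stationary (time-independent) solutions are counted as global solutions. The initial values are $\partial_t^i u(0,x)$, $i=0,1,\dots,k-1$; ''for some $w=g(x)\in\mathbb{J}_a$ and suitable initial values'' means that there exist a function $g\in\mathbb{J}_a$ and initial values for which such a solution exists. *)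

(* Defs.v *)
From HB Require Import structures.
From mathcomp Require Import all_boot all_order all_algebra.
From mathcomp Require Import all_classical all_reals all_analysis.
Set Implicit Arguments.
Unset Strict Implicit.
Unset Printing Implicit Defensive.
Import Order.TTheory GRing.Theory Num.Theory numFieldNormedType.Exports.
Local Open Scope classical_set_scope.
Local Open Scope ring_scope.

(* Product sigma-algebra on R^n, generated by the coordinate maps, as the
   library does for tuples; it is the Borel sigma-algebra of 'rV[R]_n. *)
Section rV_measurable.
Variables (R : realType) (n : nat).

Definition rV_coord (i : 'I_n) (v : 'rV[R]_n) : R := v ord0 i.

Let rV_set0 : g_sigma_preimage rV_coord set0.
Proof. exact: sigma_algebra0. Qed.

Let rV_setC A : g_sigma_preimage rV_coord A ->
  g_sigma_preimage rV_coord (~` A).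
Proof. exact: sigma_algebraC. Qed.

Let rV_bigcup (F : _^nat) : (forall i, g_sigma_preimage rV_coord (F i)) ->
  g_sigma_preimage rV_coord (\bigcup_i (F i)).
Proof. exact: sigma_algebra_bigcup. Qed.

HB.instance Definition _ :=
  @isMeasurable.Build (measure_tuple_display default_measure_display)
    'rV[R]_n (g_sigma_preimage rV_coord) rV_set0 rV_setC rV_bigcup.

End rV_measurable.

Section rV_measurability.
Context {R : realType}.

Lemma measurable_rV_coord n (i : 'I_n) :
  measurable_fun [set: 'rV[R]_n] (rV_coord i).
Proof.
move=> _ Y mY; rewrite setTI; apply: sub_sigma_algebra => /=.
rewrite -bigcup_seq/=; exists i => /=; first by rewrite mem_index_enum.
by exists Y => //; rewrite setTI.
Qed.

Lemma measurable_fun_rVP d (T : measurableType d) n (f : T -> 'rV[R]_n) :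
  (forall i, measurable_fun [set: T] (rV_coord i \o f)) ->
  measurable_fun [set: T] f.
Proof.
move=> mf; suff H : g_sigma_preimage (fun i => rV_coord i \o f) `<=` measurable.
  by rewrite g_sigma_preimage_comp in H => _ A mA; apply: H; exists A.
apply: smallest_sub; first exact: sigma_algebra_measurable.
case: n => [|n] in f mf *; first by rewrite big_ord0.
rewrite -bigcup_mkord_ord; apply: bigcup_sub => i Ii.
by move=> A [B mB <-]; exact: mf.
Qed.

Definition rV_cons n (z : measurableTypeR R * 'rV[R]_n) : 'rV[R]_n.+1 :=
  \row_i oapp (z.2 ord0) z.1 (unlift ord0 i).

Definition rV_uncons n (v : 'rV[R]_n.+1) : measurableTypeR R * 'rV[R]_n :=
  (v ord0 ord0, \row_i v ord0 (lift ord0 i)).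

Lemma rV_uncons_cons n : cancel (@rV_cons n) (@rV_uncons n).
Proof.
move=> [x v]; congr (_, _) => /=; first by rewrite mxE unlift_none.
by apply/rowP => i; rewrite !mxE liftK.
Qed.

Lemma measurable_rV_cons n : measurable_fun setT (@rV_cons n).
Proof.
apply: measurable_fun_rVP => i.
case: (unliftP ord0 i) => [j ->|->].
  rewrite (_ : _ \o _ = rV_coord j \o snd); last first.
    by apply/funext => z; rewrite /rV_coord/= mxE liftK.
  exact: measurableT_comp (@measurable_rV_coord _ j) measurable_snd.
rewrite (_ : _ \o _ = fst); first exact: measurable_fst.
by apply/funext => z; rewrite /rV_coord/= mxE unlift_none.
Qed.

Lemma measurable_rV_uncons n : measurable_fun setT (@rV_uncons n).
Proof.
apply: measurable_fun_pair; first exact: measurable_rV_coord.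
apply: measurable_fun_rVP => i.
rewrite (_ : _ \o _ = rV_coord (lift ord0 i)); first exact: measurable_rV_coord.
by apply/funext => z; rewrite /rV_coord/= mxE.
Qed.

End rV_measurability.

(* The library's canonical instance for \x only covers probabilities. *)
Lemma product_sigma_finite d1 d2 (T1 : measurableType d1)
    (T2 : measurableType d2) (R : realType)
    (m1 : {sigma_finite_measure set T1 -> \bar R})
    (m2 : {sigma_finite_measure set T2 -> \bar R}) :
  sigma_finite setT (m1 \x m2)%E.
Proof.
have /sigma_finiteP[F [TF ndF Foo]] := sigma_finiteT m1.
have /sigma_finiteP[G [TG ndG Goo]] := sigma_finiteT m2.
exists (fun n => F n `*` G n).
  rewrite -setXTT TF TG predeqE => -[x y]; split.
    move=> [/= [n _ Fnx] [k _ Gky]]; exists (maxn n k) => //; split.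
    - by move: x Fnx; exact/subsetPset/ndF/leq_maxl.
    - by move: y Gky; exact/subsetPset/ndG/leq_maxr.
  by move=> [n _ []/= ? ?]; split; exists n.
move=> k; have [? ?] := Foo k; have [? ?] := Goo k.
split; first exact: measurableX.
by rewrite product_measure1E// lte_mul_pinfty// ge0_fin_numE.
Qed.

Section lebesgue_rVS.
Context {R : realType} (n : nat).
Variable m : {sigma_finite_measure set 'rV[R]_n -> \bar R}.
Local Open Scope ereal_scope.

Definition lebesgue_rVS : set 'rV[R]_n.+1 -> \bar R :=
  pushforward (lebesgue_measure \x m) (@rV_cons R n).

Let lebesgue_rVS0 : lebesgue_rVS set0 = 0.
Proof. by rewrite /lebesgue_rVS /pushforward preimage_set0 measure0. Qed.

Let lebesgue_rVS_ge0 A : 0 <= lebesgue_rVS A.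
Proof. by rewrite /lebesgue_rVS /pushforward measure_ge0. Qed.

Let lebesgue_rVS_sigma_additive : semi_sigma_additive lebesgue_rVS.
Proof.
move=> F mF tF mUF; rewrite /lebesgue_rVS /pushforward preimage_bigcup.
apply: measure_semi_sigma_additive.
- by move=> k; rewrite -[X in measurable X]setTI; exact: measurable_rV_cons.
- apply/trivIsetP => /= i j _ _ ij; rewrite -preimage_setI.
  by move/trivIsetP : tF => /(_ _ _ _ _ ij) ->//; rewrite preimage_set0.
- by rewrite -preimage_bigcup -[X in measurable X]setTI;
    exact: measurable_rV_cons.
Qed.

HB.instance Definition _ := isMeasure.Build _ _ _ lebesgue_rVS
  lebesgue_rVS0 lebesgue_rVS_ge0 lebesgue_rVS_sigma_additive.

Let lebesgue_rVS_sigma_finite : sigma_finite setT lebesgue_rVS.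
Proof.
have [F TF Foo] := product_sigma_finite lebesgue_measure m.
exists (fun k => @rV_uncons R n @^-1` F k).
  by rewrite -preimage_bigcup -TF preimage_setT.
move=> k; have [mF Fk] := Foo k; split.
  by rewrite -[X in measurable X]setTI; exact: measurable_rV_uncons.
rewrite /lebesgue_rVS /pushforward -comp_preimage.
rewrite (_ : _ \o _ = id)//; apply/funext => z /=; exact: rV_uncons_cons.
Qed.

HB.instance Definition _ := Measure_isSigmaFinite.Build _ _ _
  lebesgue_rVS lebesgue_rVS_sigma_finite.

End lebesgue_rVS.

(* Lebesgue measure on R^n: a point mass for n = 0, then the product of
   one-dimensional Lebesgue measure with the measure on R^(n-1). *)
Fixpoint lebesgue_rV (R : realType) (n : nat) :
    {sigma_finite_measure set 'rV[R]_n -> \bar R} :=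
  if n is n'.+1 then lebesgue_rVS (lebesgue_rV R n')
  else \d_(0 : 'rV[R]_0).

Section spacetime.
Context {R : realType} {N : nat}.
Local Notation space := 'rV[R]_N.
Local Notation spacetime := (R * 'rV[R]_N)%type.
Implicit Types (f u v w phi : spacetime -> R) (z : spacetime).

(* Euclidean norm; the library's `|x| on 'rV is the sup norm. *)
Definition enorm (x : space) : R := Num.sqrt (\sum_i x ord0 i ^+ 2).

Definition Q : set spacetime := [set z | 0 < z.1].

Definition lebesgue_tx : set (measurableTypeR R * space) -> \bar R :=
  (lebesgue_measure \x lebesgue_rV R N)%E.

HB.instance Definition _ := Measure.on lebesgue_tx.

Definition et : spacetime := (1, 0).
Definition ex (i : 'I_N) : spacetime := (0, delta_mx ord0 i).

(* dt i f is the i-th classical time derivative of f. *)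
Definition dt (i : nat) f : spacetime -> R :=
  iter i (fun g z => 'D_et g z) f.

Definition laplacian f z : R :=
  \sum_(i < N) 'D_(ex i) (fun z' => 'D_(ex i) f z') z.

Fixpoint Ck (m : nat) f : Prop :=
  continuous f /\
  if m is m'.+1 then
    forall e, e = et \/ (exists i, e = ex i) ->
      (forall z, derivable f z e) /\ Ck m' (fun z => 'D_e f z)
  else True.

(* Functions compactly supported in Q, extended by 0 to R * R^N. *)
Definition compactly_supported_in_Q f : Prop :=
  exists K : set spacetime,
    [/\ compact K, K `<=` Q & forall z, ~ K z -> f z = 0].

Definition Cc2 f : Prop := Ck 2 f /\ compactly_supported_in_Q f.

Definition Ccoo f : Prop := (forall m, Ck m f) /\ compactly_supported_in_Q f.

(* L^r_loc(Q). Measurability is Borel: every class of Lebesgue measurable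
   functions modulo null sets has a Borel representative. *)
Definition Lloc (r : R) f : Prop :=
  measurable_fun (Q : set (measurableTypeR R * space)) f /\
  forall K : set spacetime, compact K -> K `<=` Q ->
    (\int[lebesgue_tx]_(z in K) (`|f z| `^ r)%:E < +oo)%E.

Definition distributional_dt (j : nat) u v : Prop :=
  forall phi, Ccoo phi ->
    \int[lebesgue_tx]_(z in Q) (v z * phi z) =
    (-1) ^+ j * \int[lebesgue_tx]_(z in Q) (u z * dt j phi z).

(* v stands for the (k-1)-st time derivative of u. *)
Definition weak_solution (k : nat) (p q : R) w u v : Prop :=
  [/\ Lloc p u, Lloc q v, distributional_dt k.-1 u v &
    forall phi, Cc2 phi ->
      \int[lebesgue_tx]_(z in Q)
        ((`|u z| `^ p + `|v z| `^ q + w z) * phi z) =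
      (- \int[lebesgue_tx]_(z in Q) (v z * dt 1 phi z))
      - \int[lebesgue_tx]_(z in Q) (u z * laplacian phi z)].

(* The i-th initial value is the limit as t -> 0+ of the classical i-th time
   derivative, required to exist for small t > 0. *)
Definition has_initial_values (k : nat) u (u0 : 'I_k -> space -> R) : Prop :=
  forall (i : 'I_k) (x : space),
    (forall j, (j < i)%N -> \forall t \near 0^'+, derivable (dt j u) (t, x) et)
    /\ dt i u (t, x) @[t --> 0^'+] --> u0 i x.

Definition positive_global_solution (k : nat) (p q : R) w
    (u0 : 'I_k -> space -> R) u : Prop :=
  [/\ exists v, weak_solution k p q w u v,
      forall z, Q z -> 0 < u z & has_initial_values u u0].

Definition Ia (a : R) (g : space -> R) : Prop :=
  [/\ continuous g, forall x, 0 <= g x &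
    exists C M : R, 0 < C /\
      forall x, M <= enorm x -> C * enorm x `^ (- a) <= g x].

Definition Ja (a : R) (g : space -> R) : Prop :=
  [/\ continuous g, forall x, 0 < g x &
    exists C M : R, 0 < C /\
      forall x, M <= enorm x -> g x <= C * enorm x `^ (- a)].

End spacetime.

(* Main.v *)
Require Import Defs.
From mathcomp Require Import all_boot all_order all_algebra.
From mathcomp Require Import all_classical all_reals all_analysis.
From mathcomp Require Import measurable_realfun ring lra.
Set Implicit Arguments.
Unset Strict Implicit.
Unset Printing Implicit Defensive.
Import Order.TTheory GRing.Theory Num.Theory numFieldNormedType.Exports.
Local Open Scope classical_set_scope.
Local Open Scope ring_scope.

(** Nonexistence: test the equation against
    [phi = (1 - |x|^2/rho^2)_+^m (1 - (t - 2 tau)^2/tau^2)_+^m]. For [m] large,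
    [|Delta phi| <= C rho^-2 phi^(1/p)] and [|d_t phi| <= C tau^-1 phi^(1/q)], so
    Young's inequality absorbs [u Delta phi] and [v d_t phi] into
    [(|u|^p + |v|^q) phi]; what remains is
    [int w phi <= C (rho^(-2p') + tau^(-q')) |supp phi|] with
    [p' = p/(p-1)], [q' = q/(q-1)]. Since [w >= C rho^-a] on a fixed proportion of
    [supp phi], choosing [tau] with [tau^(-q') ~ rho^(-2p')] gives
    [rho^-a <= C rho^(-2p')] for all large [rho], which fails for
    [a < 2p' = astar].

    Existence: [u = eps (1 + |x|^2)^(1 - a/2)] is stationary and
    [- Delta u] is comparable to [eps (1 + |x|^2)^(-a/2)] because [2 < a < N], while
    [u^p <= eps^p (1 + |x|^2)^(-a/2)] exactly when [a >= astar]; so for [eps] small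
    [w = - Delta u - u^p] is positive and [O(|x|^-a)]. That [u] is a weak solution
    follows from [int D_e F = 0] for compactly supported [F], applied to
    [u D_i phi - D_i u phi]. *)

(** * Boxes in spacetime: measurability and volume *)

Section boxes.
Context {R : realType}.

Definition box n (lo hi : 'rV[R]_n) : set 'rV[R]_n :=
  [set v | forall i, v ord0 i \in `[lo ord0 i, hi ord0 i]].

Lemma measurable_box n (lo hi : 'rV[R]_n) : measurable (box lo hi).
Proof.
have -> : box lo hi = \bigcap_(i in [set: 'I_n])
    (rV_coord i @^-1` `[lo ord0 i, hi ord0 i]%classic).
  apply/seteqP; split => v /= H; first by move=> i _; exact: H.
  by move=> i; exact: (H i I).
apply: fin_bigcap_measurable => // i _.
rewrite -[X in measurable X]setTI; apply: measurable_rV_coord => //.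
Qed.

Lemma open_measurable_tx n (U : set (R * 'rV[R]_n)) : open U ->
  measurable (U : set (measurableTypeR R * 'rV[R]_n)).
Proof.
move=> oU.
(* An open set is the countable union of the closed grid cells it contains. *)
pose cell (c : nat * (int * 'rV[int]_n)) : set (measurableTypeR R * 'rV[R]_n) :=
  `[c.2.1%:~R / c.1.+1%:R, (c.2.1 + 1)%:~R / c.1.+1%:R] `*`
  box (\row_i ((c.2.2 ord0 i)%:~R / c.1.+1%:R))
      (\row_i ((c.2.2 ord0 i + 1)%:~R / c.1.+1%:R)).
have -> : U = \bigcup_c (if `[< cell c `<=` U >] then cell c else set0).
  apply/seteqP; split => [z Uz|z [c _]]; last by case: asboolP => // + zc; exact.
  have /nbhs_ballP[e /= e0 eU] : nbhs z U by exact: open_nbhs_nbhs.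
  (* Grid cells of side 1/(k+1) < e: the cell around [z] lies in the e-ball, which is checked
     coordinate by coordinate because balls are taken in the sup norm. *)
  have [k] := ltr_add_invr e0; rewrite add0r => ke.
  pose fl (x : R) := Num.floor (x * k.+1%:R).
  have cellP x y : y \in `[(fl x)%:~R / k.+1%:R, (fl x + 1)%:~R / k.+1%:R] ->
      ball x e y.
    have /andP[] := floor_itv (x * k.+1%:R); rewrite -/(fl x) rmorphD /=.
    rewrite in_itv /= ler_pdivrMr// ler_pdivlMr// => h1 h2 /andP[h3 h4].
    apply: le_lt_trans ke; rewrite -[k.+1%:R^-1]mul1r ler_pdivlMr//.
    by rewrite -[X in _ * X]ger0_norm// -normrM ler_norml; apply/andP; split; lra.
  have flP x : x \in `[(fl x)%:~R / k.+1%:R, (fl x + 1)%:~R / k.+1%:R].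
    have /andP[h1 /ltW h2] := floor_itv (x * k.+1%:R).
    by rewrite in_itv/= ler_pdivrMr// ler_pdivlMr// h1 h2.
  exists (k, (fl z.1, \row_i fl (z.2 ord0 i))) => //.
  case: asboolP => [_|].
    by split => /=; [exact: flP|move=> i; rewrite !mxE; exact: flP].
  case=> w [/= /cellP w1 w2]; apply: eU; split => //=; split => // i j.
  by rewrite ord1; apply: cellP; have := w2 j; rewrite !mxE.
apply: countable_bigcupT_measurable => // c; case: ifP => // _.
by apply: measurableX; [exact: measurable_itv|exact: measurable_box].
Qed.

Lemma continuous_measurable_tx n (f : R * 'rV[R]_n -> R) : continuous f ->
  measurable_fun setT (f : measurableTypeR R * 'rV[R]_n -> measurableTypeR R).
Proof.
move=> cf; apply: (measurability _ (RGenOpens.measurableE R)).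
move=> _ [_ [a [b ->] <-]]; rewrite setTI; apply: open_measurable_tx.
by apply: open_comp => // x _; exact: cf.
Qed.

(** Induction on the dimension: the preimage of a box under [rV_cons] is an interval times a box of
    one dimension less. A degenerate side gives zero on both sides. *)
Lemma lebesgue_rV_box n (lo hi : 'rV[R]_n) :
  (forall i, lo ord0 i <= hi ord0 i) ->
  lebesgue_rV R n (box lo hi) = (\prod_i (hi ord0 i - lo ord0 i))%:E.
Proof.
elim: n lo hi => [|n IH] lo hi lohi.
  rewrite big_ord0 /= diracE mem_set//=; by case.
rewrite big_ord_recl /=.
rewrite [LHS](_ : _ = ((lebesgue_measure \x lebesgue_rV R n)
   (`[lo ord0 ord0, hi ord0 ord0]%classic `*`
    box (\row_i lo ord0 (lift ord0 i)) (\row_i hi ord0 (lift ord0 i))))%E).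
  rewrite product_measure1E//; last exact: measurable_box.
  rewrite IH; last by move=> i; rewrite !mxE.
  rewrite [X in (X * _)%E]lebesgue_measure_itv/= lte_fin.
  under eq_bigr do rewrite !mxE.
  case: ltP => [_|h]; first by rewrite -EFinD -EFinM.
  have -> : hi ord0 ord0 = lo ord0 ord0 by apply/eqP; rewrite eq_le h lohi.
  by rewrite mul0e subrr mul0r.
rewrite /lebesgue_rVS /pushforward; congr (_ _).
apply/seteqP; split => -[t v] /=.
  move=> H; split; first by have := H ord0; rewrite /= mxE unlift_none.
  by move=> i; have := H (lift ord0 i); rewrite /= !mxE liftK.
move=> [H1 H2] i; case: (unliftP ord0 i) => [j ->|->].
  by have := H2 j; rewrite !mxE liftK.
by rewrite mxE unlift_none.
Qed.

Lemma lebesgue_tx_box n (a b : R) (lo hi : 'rV[R]_n) :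
  a <= b -> (forall i, lo ord0 i <= hi ord0 i) ->
  lebesgue_tx (`[a, b]%classic `*` box lo hi) =
  ((b - a) * \prod_i (hi ord0 i - lo ord0 i))%:E.
Proof.
move=> ab lohi; rewrite /lebesgue_tx product_measure1E//; last first.
  exact: measurable_box.
rewrite lebesgue_rV_box// [X in (X * _)%E]lebesgue_measure_itv/= lte_fin.
case: ltP => [_|ba]; first by rewrite -EFinD -EFinM.
by rewrite mul0e (_ : b = a) ?subrr ?mul0r//; apply/eqP; rewrite eq_le ab ba.
Qed.

End boxes.

(** The difference quotients of [F \o c] along [e'] and of [F] along [e] are the same function of
    the increment, so directional derivatives transfer with no total differentiability of [F].
    Slices, projections and [rV_cons] are all instances of [c]. *)
Lemma is_derive_affine (R : realType) (V W U : normedModType R) (c : W -> V)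
    (e' : W) (e : V) (z : W) (F : V -> U) (d : U) :
  (forall h, c (h *: e' + z) = h *: e + c z) ->
  is_derive (c z) e F d -> is_derive z e' (F \o c) d.
Proof.
move=> ce [dF DF].
have E : (fun h => h^-1 *: ((F \o c \o shift z) (h *: e') - (F \o c) z)) =
    (fun h => h^-1 *: ((F \o shift (c z)) (h *: e) - F (c z))).
  by apply/funext => h; rewrite /= ce.
by split; [rewrite /derivable E|rewrite /derive E].
Qed.

Lemma continuous_pair (T U V : topologicalType) (f : T -> U) (g : T -> V) (x : T) :
  {for x, continuous f} -> {for x, continuous g} ->
  {for x, continuous (fun y => (f y, g y))}.
Proof. move=> cf cg; exact: (cvg_pair cf cg). Qed.

(** * The integral of a derivative of a compactly supported function vanishes *)

Section divergence.
Context {R : realType}.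

Lemma bounded_support_integrable n (f : R * 'rV[R]_n -> R) (M B : R) :
  measurable_fun setT (f : measurableTypeR R * 'rV[R]_n -> measurableTypeR R) ->
  (forall z, `|f z| <= B) ->
  (forall z, M < `|z.1| -> f z = 0) ->
  (forall (z : R * 'rV[R]_n) (i : 'I_n), M < `|z.2 ord0 i| -> f z = 0) ->
  lebesgue_tx.-integrable [set: measurableTypeR R * 'rV[R]_n] (EFin \o f).
Proof.
move=> mf fB f1 f2.
(* [M] may be negative, while the volume formula needs [- m <= m]. *)
pose m := Num.max M 0.
pose K : set (measurableTypeR R * 'rV[R]_n) :=
  `[- m, m]%classic `*` box (const_mx (- m)) (const_mx m).
have mK : measurable K.
  by apply: measurableX; [exact: measurable_itv|exact: measurable_box].
have m0 : 0 <= m by rewrite le_max lexx orbT.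
have fK : f = f \_ K.
  apply/funext => z; rewrite patchE; case: ifPn => // /negP; rewrite inE => zK.
  apply: contra_notP zK => /eqP fz0; split => /=.
    rewrite in_itv /= -ler_norml leNgt; apply: contra fz0 => mz.
    by apply/eqP/f1; apply: le_lt_trans mz; rewrite le_max lexx.
  move=> i; rewrite !mxE in_itv /= -ler_norml leNgt; apply: contra fz0 => mz.
  by apply/eqP/(f2 _ i); apply: le_lt_trans mz; rewrite le_max lexx.
rewrite fK -restrict_EFin; apply/integrable_restrict => //; rewrite setTI.
apply: measurable_bounded_integrable => //.
- change (lebesgue_tx K < +oo)%E.
  rewrite lebesgue_tx_box ?ltry// => [|i]; rewrite ?mxE; lra.
- exact: measurable_funTS.
- by exists B; split; [exact: num_real|move=> b /ltW Bb z _ /=; exact: le_trans Bb].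
Qed.

(** Fundamental theorem of calculus on an interval so large that [F] vanishes at both ends and [G]
    vanishes outside. *)
Lemma integral_derive_R (F G : R -> R) (M : R) :
  (forall t : R, is_derive t 1 F (G t)) -> continuous G ->
  (forall t, M < `|t| -> F t = 0 /\ G t = 0) ->
  (\int[lebesgue_measure]_t (G t)%:E = 0)%E.
Proof.
move=> FG cG out.
pose m := `|M| + 1.
have m0 : 0 < m by rewrite ltr_wpDl.
have Mm : M < m by rewrite /m; have := ler_norm M; lra.
have G0 : (EFin \o G) = (EFin \o G) \_ `[- m, m].
  apply/funext => t; rewrite patchE; case: ifPn => // /negP.
  rewrite inE/= in_itv/= -ler_norml => /negP; rewrite -ltNge => mt.
  by rewrite (out t _).2//; exact: lt_trans mt.
rewrite (_ : (fun t => _) = (EFin \o G)) // G0 -integral_mkcond.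
have mm : - m < m by lra.
have cF : continuous F.
  by move=> t; apply/differentiable_continuous/derivable1_diffP; case: (FG t).
rewrite (@continuous_FTC2 _ _ F)//.
- rewrite (out m _).1 ?(out (-m) _).1 ?subee// ?normrN ger0_norm//; exact: ltW.
- by apply: continuous_subspaceT.
- split; first by move=> t _; case: (FG t).
    exact: cvg_at_right_filter (cF _).
  exact: cvg_at_left_filter (cF _).
- by move=> t _; rewrite derive1E; case: (FG t).
Qed.

(** This statement and [divergence_tx] are proved by a joint induction: dimension [n] in space gives
    spacetime over it, which in turn gives dimension [n.+1]. The uniform bound [B] and the cube of
    size [M] provide the integrability that Fubini requires. *)
Definition divergence_rV n : Prop :=
  forall (i : 'I_n) (F G : 'rV[R]_n -> R) (M B : R),
  (forall x, is_derive x (delta_mx ord0 i : 'rV[R]_n) F (G x)) -> continuous G ->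
  (forall x, `|G x| <= B) ->
  (forall (x : 'rV[R]_n) (j : 'I_n), M < `|x ord0 j| -> F x = 0 /\ G x = 0) ->
  (\int[lebesgue_rV R n]_x (G x)%:E = 0)%E.

Definition divergence_tx n : Prop :=
  forall (e : R * 'rV[R]_n) (F G : R * 'rV[R]_n -> R) (M B : R),
  e = et \/ (exists i, e = ex i) ->
  (forall z, is_derive z e F (G z)) -> continuous G ->
  (forall z, `|G z| <= B) ->
  (forall z, M < `|z.1| -> F z = 0 /\ G z = 0) ->
  (forall (z : R * 'rV[R]_n) (j : 'I_n), M < `|z.2 ord0 j| -> F z = 0 /\ G z = 0) ->
  (\int[lebesgue_tx]_z (G z)%:E = 0)%E.

(** Fubini, integrating first in the factor that contains the direction of differentiation: the
    inner integral is already zero, by the one-dimensional case for [et] and by hypothesis for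
    [ex i]. *)
Lemma divergence_rV_tx n : divergence_rV n -> divergence_tx n.
Proof.
move=> IH e F G M B He FG cG GB out1 out2.
have intG : (lebesgue_measure \x lebesgue_rV R n)%E.-integrable
    [set: measurableTypeR R * 'rV[R]_n] (EFin \o G).
  apply: (@bounded_support_integrable _ _ M B) => //.
  - exact: continuous_measurable_tx.
  - by move=> z /out1[].
  - by move=> z i /out2[].
case: He => [|[i]] ?; subst e.
  transitivity (\int[lebesgue_rV R n]_x \int[lebesgue_measure]_t (G (t, x))%:E)%E.
    by rewrite (integral21_prod_meas1 intG).
  apply: integral0_eq => x _.
  apply: (@integral_derive_R (fun t => F (t, x)) _ M).
  - move=> t; apply: (@is_derive_affine _ _ _ _ (fun t => (t, x)) _ et) => h //.
    by rewrite /et; congr (_, _); rewrite /= scaler0 add0r.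
  - move=> t; apply: continuous_comp; last exact: cG.
    by apply: continuous_pair; [exact: cvg_id|exact: cvg_cst].
  - by move=> t /(out1 (t, x)).
transitivity (\int[lebesgue_measure]_t \int[lebesgue_rV R n]_x (G (t, x))%:E)%E.
  by rewrite (integral12_prod_meas1 intG).
apply: integral0_eq => t _.
apply: (@IH i (fun x => F (t, x)) _ M B) => //.
- move=> x; apply: (@is_derive_affine _ _ _ _ (fun x => (t, x)) _ (ex i)) => h //.
  by rewrite /ex; congr (_, _); rewrite /= scaler0 add0r.
- move=> x; apply: (@continuous_comp _ _ _ (fun y => (t, y)) G); last exact: cG.
  by apply: (@continuous_pair _ _ _ (fun=> t) id); [exact: cst_continuous|exact: cvg_id].
- by move=> x j; exact: (out2 (t, x)).
Qed.

Lemma continuous_rV_cons n : continuous (@rV_cons R n).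
Proof.
move=> z; apply/cvg_ballP => e e0; apply: filterS (nbhsx_ballx z e e0).
move=> w [w1 [_ w2]]; split => // i j; rewrite ord1 !mxE.
by case: unliftP => [k _|_] //=; exact: w2.
Qed.

Lemma rV_consZD n (h : R) (y z : R * 'rV[R]_n) :
  rV_cons (h *: y + z) = h *: rV_cons y + rV_cons z.
Proof.
by apply/rowP => i; rewrite !mxE; case: unliftP => [j _|_] //=; rewrite !mxE.
Qed.

(** The measure on dimension [n.+1] is the image of the spacetime measure under the linear map
    [rV_cons], which sends [et] to the first basis vector and [ex j] to the next ones. So everything
    pulls back to spacetime. *)
Lemma divergence_tx_rV n : divergence_tx n -> divergence_rV n.+1.
Proof.
move=> IH i F G M B FG cG GB out.
(* [G] factors through spacetime, where continuity is known to give measurability. *)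
have mG : measurable_fun setT (G : 'rV[R]_n.+1 -> measurableTypeR R).
  have -> : G = G \o @rV_cons R n \o @rV_uncons R n.
    apply/funext => x /=; congr (G _); apply/rowP => j; rewrite mxE.
    by case: unliftP => [k ->|->] //=; rewrite mxE.
  apply: measurableT_comp; last exact: measurable_rV_uncons.
  apply: continuous_measurable_tx => z; apply: continuous_comp; last exact: cG.
  exact: continuous_rV_cons.
have out1 (z : R * 'rV[R]_n) : M < `|z.1| -> F (rV_cons z) = 0 /\ G (rV_cons z) = 0.
  by move=> Mz; apply: (out _ ord0); rewrite mxE unlift_none.
have out2 (z : R * 'rV[R]_n) (j : 'I_n) : M < `|z.2 ord0 j| ->
    F (rV_cons z) = 0 /\ G (rV_cons z) = 0.
  by move=> Mz; apply: (out _ (lift ord0 j)); rewrite mxE liftK.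
have cGc : continuous (G \o @rV_cons R n).
  by move=> z; apply: continuous_comp; [exact: continuous_rV_cons|exact: cG].
rewrite /= /lebesgue_rVS integral_pushforward//=; first last.
- apply: (@bounded_support_integrable _ (G \o @rV_cons R n) M B) => //.
  + exact: continuous_measurable_tx.
  + by move=> z; exact: GB.
  + by move=> z /out1[].
  + by move=> z j /out2[].
- exact/measurable_EFinP.
- exact: measurable_rV_cons.
rewrite preimage_setT; pose e : R * 'rV[R]_n := 
  if unlift ord0 i is Some j then ex j else et.
apply: (@IH e (F \o @rV_cons R n) _ M B) => //.
  by rewrite /e; case: unlift => [j|]; [right; exists j|left].
move=> z; apply: (@is_derive_affine _ _ _ _ (@rV_cons R n) _ (delta_mx ord0 i)) => //.
move=> h; rewrite rV_consZD; congr (_ *: _ + _); apply/rowP => j.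
rewrite !mxE /e; case: (unliftP ord0 i) => [k ->|->] /=.
  case: (unliftP ord0 j) => [l ->|->] /=; rewrite ?mxE ?(inj_eq (@lift_inj _ ord0))//.
case: (unliftP ord0 j) => [l ->|->] /=; rewrite ?mxE//.
Qed.

Lemma integral_derive_tx n : divergence_tx n.
Proof.
(* In dimension 0 there is no direction [i], so the base case is vacuous. *)
apply: divergence_rV_tx; elim: n => [[]//|n IH]; exact/divergence_tx_rV/divergence_rV_tx.
Qed.

End divergence.

(** * Closure properties of the classes [Ck] *)

Section Ck_theory.
Context {R : realType} {N : nat}.
Local Notation spacetime := (R * 'rV[R]_N)%type.
Implicit Types (f g : spacetime -> R) (z e : spacetime).

Lemma Ck_continuous m f : Ck m f -> continuous f.
Proof. by case: m => [|m] []. Qed.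

Lemma CkS m f : Ck m.+1 f -> Ck m f.
Proof.
elim: m f => [|m IH] f [cf H]; first by split.
by split=> // e /H[df Df]; split => //; apply: IH.
Qed.

Lemma Ck_cst m (c : R) : Ck m (cst c : spacetime -> R).
Proof.
elim: m c => [|m IH] c; split; try exact: cst_continuous; first by [].
move=> e _; split; first by move=> z; exact: derivable_cst.
rewrite (_ : (fun z => _) = cst 0)//.
by apply/funext => z; rewrite derive_cst.
Qed.

Lemma CkD m f g : Ck m f -> Ck m g -> Ck m (f + g).
Proof.
elim: m f g => [|m IH] f g [cf Hf] [cg Hg].
  by split => // z; apply: continuousD; [exact: cf|exact: cg].
split; first by move=> z; apply: continuousD; [exact: cf|exact: cg].
move=> e he; have [df Df] := Hf _ he; have [dg Dg] := Hg _ he; split.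
  by move=> z; exact: derivableD.
rewrite (_ : (fun z => _) = (fun z => 'D_e f z) + (fun z => 'D_e g z)).
  exact: IH.
by apply/funext => z; rewrite deriveD.
Qed.

Lemma CkM m f g : Ck m f -> Ck m g -> Ck m (f * g).
Proof.
elim: m f g => [|m IH] f g Hf Hg; have cf := Ck_continuous Hf;
  have cg := Ck_continuous Hg.
  by split => // z; apply: continuousM; [exact: cf|exact: cg].
split; first by move=> z; apply: continuousM; [exact: cf|exact: cg].
have [_ {}Df] := Hf; have [_ {}Dg] := Hg.
move=> e he; have [df Df'] := Df _ he; have [dg Dg'] := Dg _ he; split.
  by move=> z; exact: derivableM.
rewrite (_ : (fun z => _) =
  f * (fun z => 'D_e g z) + g * (fun z => 'D_e f z)).
  by apply: CkD; apply: IH => //; exact: CkS.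
by apply/funext => z; rewrite deriveM.
Qed.

Lemma Ck_sum m I (r : seq I) (F : I -> spacetime -> R) :
  (forall i, Ck m (F i)) -> Ck m (\sum_(i <- r) F i).
Proof.
by move=> HF; elim/big_ind : _ => //; [exact: Ck_cst|exact: CkD].
Qed.

Lemma is_derive_linear (f : spacetime -> R) e z :
  (forall h, f (h *: e + z) = h *: f e + f z) -> is_derive z e f (f e).
Proof.
move=> fl; exact: (@is_derive_affine _ _ _ _ f _ (f e) _ id).
Qed.

Lemma is_derive_fst e z : is_derive z e (fun z : spacetime => z.1) e.1.
Proof. exact: is_derive_linear. Qed.

Lemma is_derive_coord i e z :
  is_derive z e (fun z : spacetime => z.2 ord0 i) (e.2 ord0 i).
Proof.
by apply: (is_derive_linear (f := fun z : spacetime => z.2 ord0 i)) => h /=;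
  rewrite !mxE.
Qed.

Lemma continuous_coord i : continuous (fun z : spacetime => z.2 ord0 i).
Proof.
move=> z; apply: (@continuous_comp _ _ _ snd (fun v : 'rV[R]_N => v ord0 i)).
  exact: cvg_snd.
exact: coord_continuous.
Qed.

Lemma Ck_fst m : Ck m (fun z : spacetime => z.1).
Proof.
have c1 : continuous (fun z : spacetime => z.1) by move=> z; exact: cvg_fst.
case: m => [|m]; split => // e _; split.
  by move=> z; case: (is_derive_fst e z).
rewrite (_ : (fun z => _) = cst e.1); first exact: Ck_cst.
by apply/funext => z; case: (is_derive_fst e z).
Qed.

Lemma Ck_coord m i : Ck m (fun z : spacetime => z.2 ord0 i).
Proof.
case: m => [|m]; split; rewrite //; try exact: continuous_coord.
move=> e _; split; first by move=> z; case: (is_derive_coord i e z).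
rewrite (_ : (fun z => _) = cst (e.2 ord0 i)); first exact: Ck_cst.
by apply/funext => z; case: (is_derive_coord i e z).
Qed.

End Ck_theory.

(** Restricting [f] to the line through [z] in direction [e] reduces this to the one-variable chain
    rule; only the directional derivative of [f] is involved. *)
Lemma is_derive_comp1 (R : realType) (V : normedModType R) (f : V -> R)
    (h : R -> R) (z e : V) (df dh : R) :
  is_derive z e f df -> is_derive (f z) 1 h dh ->
  is_derive z e (h \o f) (dh * df).
Proof.
pose l (t : R) := t *: e + z.
have lE t : l (t *: 1 + 0) = t *: e + l 0.
  by rewrite /l scale0r add0r addr0 [t *: 1]mulr1.
have l0 : l 0 = z by rewrite /l scale0r add0r.
move=> Df Dh.
have Dfl : is_derive (0 : R) 1 (f \o l) df.
  by apply: (is_derive_affine lE); rewrite l0.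
have Dh' : is_derive ((f \o l) 0) 1 h dh by rewrite /= l0.
have [D1 D2] := is_derive1_comp Dh' Dfl.
have E : (fun t => t^-1 *: ((h \o f \o shift z) (t *: e) - (h \o f) z)) =
         (fun t => t^-1 *: (((h \o (f \o l)) \o shift 0) (t *: 1) - (h \o (f \o l)) 0)).
  by apply/funext => t; rewrite /= l0 /l addr0 [t *: 1]mulr1.
by split; [rewrite /derivable E|rewrite -D2 /derive E].
Qed.

(** * Powers of the positive part *)

Section pos_pow.
Context {R : realType}.

Definition pos_pow m (s : R) : R := Num.max s 0 ^+ m.

Lemma continuous_pos_pow m : continuous (pos_pow m).
Proof.
move=> s; apply: (@continuous_comp _ _ _ (fun s : R => Num.max s 0) (fun t => t ^+ m)).
  by apply: continuous_max; [exact: cvg_id|exact: cst_continuous].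
exact: exprn_continuous.
Qed.

Lemma is_derive_pos_pow m (s : R) :
  is_derive s 1 (pos_pow m.+2) (m.+2%:R * pos_pow m.+1 s).
Proof.
have [s0|s0|->] := ltgtP s 0.
- rewrite /pos_pow [Num.max s 0]max_r ?ltW// expr0n/= mulr0.
  apply: (@near_eq_is_derive _ _ _ (cst 0)).
  near=> t; rewrite max_r ?expr0n//= ltW//; near: t; exact: lt_nbhsl.
- rewrite /pos_pow [Num.max s 0]max_l ?ltW//.
  have Ds : is_derive s 1 (id ^+ m.+2 : R -> R) (m.+2%:R * s ^+ m.+1).
    by apply: is_derive_eq; rewrite [LHS]mulr1.
  apply: near_eq_is_derive Ds; near=> t.
  by rewrite fctE max_l// ltW//; near: t; exact: lt_nbhsr.
rewrite /pos_pow maxxx expr0n/= mulr0.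
(* At the kink, the difference quotient with nonzero increment [h] is exactly [pos_pow m.+1 h],
   which tends to 0 because its exponent is positive. *)
have q0 : h^-1 *: ((pos_pow m.+2 \o shift 0) (h *: (1 : R)) - pos_pow m.+2 0)
    @[h --> (0 : R)^'] --> (0 : R).
  have : pos_pow m.+1 @ (0 : R)^' --> (0 : R).
    have /cvg_within_filter : pos_pow m.+1 @ (0 : R) --> pos_pow m.+1 0.
      exact: continuous_pos_pow.
    by rewrite /pos_pow maxxx expr0n; exact.
  apply: cvg_trans; apply: near_eq_cvg; near=> h.
  have h0 : h != 0 by near: h; exact: nbhs_dnbhs_neq.
  rewrite /pos_pow /= addr0 [h *: 1]mulr1 maxxx expr0n subr0 [LHS]exprS.
  rewrite [in RHS]exprS exprS [RHS]/GRing.scale /=.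
  by have [h1|h1] := leP h 0; rewrite ?mul0r ?mulr0 ?mulKf.
by split; [apply/cvg_ex; exists 0; exact: q0|exact: cvg_lim q0].
Unshelve. all: by end_near. Qed.

(** Each derivative costs one power, and exponent 1 is still continuous; hence [m] derivatives call
    for an exponent of at least [m.+1]. *)
Lemma Ck_pos_pow {N : nat} m n (f : R * 'rV[R]_N -> R) :
  Ck m f -> Ck m (pos_pow (m + n).+1 \o f).
Proof.
elim: m n => [|m IH] n Hf; have cf := Ck_continuous Hf.
  by split => // z; apply: continuous_comp; [exact: cf|exact: continuous_pos_pow].
split.
  by move=> z; apply: continuous_comp; [exact: cf|exact: continuous_pos_pow].
move=> e he; have [df Df] := Hf.2 _ he.
have D z : is_derive z e (pos_pow (m.+1 + n).+1 \o f)
    ((m.+1 + n).+1%:R * pos_pow (m + n).+1 (f z) * 'D_e f z).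
  by apply: is_derive_comp1; [exact: derivableP|exact: is_derive_pos_pow].
split; first by move=> z; case: (D z).
rewrite (_ : (fun z => _) =
  cst (m.+1 + n).+1%:R * (pos_pow (m + n).+1 \o f) * (fun z => 'D_e f z)).
  by apply: CkM => //; apply: CkM; [exact: Ck_cst|exact/IH/CkS].
by apply/funext => z; case: (D z).
Qed.

End pos_pow.

(** * Derivatives of radial functions times a function of time *)

Section radial.
Context {R : realType} {N : nat}.
Local Notation spacetime := (R * 'rV[R]_N)%type.
Implicit Types (z e : spacetime).

Definition sqnorm z : R := \sum_i z.2 ord0 i ^+ 2.

Lemma sqnorm_ge0 z : 0 <= sqnorm z.
Proof. by apply: sumr_ge0 => i _; exact: sqr_ge0. Qed.

Lemma Ck_sqnorm m : Ck m sqnorm.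
Proof.
rewrite (_ : sqnorm = \sum_i (fun z => z.2 ord0 i) * (fun z => z.2 ord0 i)).
  by apply: Ck_sum => i; apply: CkM; exact: Ck_coord.
by apply/funext => z; rewrite /sqnorm fct_sumE.
Qed.

Lemma is_derive_sqnorm e z :
  is_derive z e sqnorm (\sum_i 2 * z.2 ord0 i * e.2 ord0 i).
Proof.
rewrite (_ : sqnorm = \sum_i (fun z => z.2 ord0 i) * (fun z => z.2 ord0 i)).
  apply: is_derive_sum => i; have Di := is_derive_coord i e z.
  by apply: is_derive_eq; rewrite /GRing.scale /=; ring.
by apply/funext => z'; rewrite /sqnorm fct_sumE.
Qed.

Lemma is_derive_sqnorm_ex i z : is_derive z (ex i) sqnorm (2 * z.2 ord0 i).
Proof.
apply: (is_derive_eq (is_derive_sqnorm _ _)).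
rewrite (bigD1 i)//= mxE !eqxx mulr1 big1 ?addr0// => j ji.
by rewrite mxE (negbTE ji) andbF mulr0.
Qed.

Lemma is_derive_sqnorm_et z : is_derive z et sqnorm 0.
Proof.
by apply: (is_derive_eq (is_derive_sqnorm _ _)); rewrite big1// => j _; rewrite mxE mulr0.
Qed.

Lemma is_derive_time_ex (eta : R -> R) i z :
  is_derive z (ex i) (fun z : spacetime => eta z.1) 0.
Proof.
apply: (@is_derive_affine _ _ _ _ (fun z : spacetime => z.1) _ 0); last exact: is_derive0.
by move=> h /=; rewrite !scaler0.
Qed.

Section radial_mul.
Variables (h h1 h2 eta : R -> R).
Hypothesis hD : forall s : R, 0 <= s -> is_derive s 1 h (h1 s).
Hypothesis h1D : forall s : R, 0 <= s -> is_derive s 1 h1 (h2 s).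
Let f z := h (sqnorm z) * eta z.1.

(** Both the cutoff and the stationary solution have this shape. A profile in s = |x|^2 rather than
    in |x| avoids the singularity at the origin, and asking for its derivatives only at s >= 0
    admits powers of 1 + s. *)
Lemma is_derive_radial_ex i z :
  is_derive z (ex i) f (2 * z.2 ord0 i * h1 (sqnorm z) * eta z.1).
Proof.
have D1 := is_derive_comp1 (is_derive_sqnorm_ex i z) (hD (sqnorm_ge0 z)).
have D2 := is_derive_time_ex eta i z.
rewrite (_ : f = (h \o sqnorm) * (fun z => eta z.1))//.
by apply: is_derive_eq; rewrite /GRing.scale /=; ring.
Qed.

Lemma is_derive2_radial_ex i z :
  is_derive z (ex i) (fun z => 'D_(ex i) f z)
    ((4 * z.2 ord0 i ^+ 2 * h2 (sqnorm z) + 2 * h1 (sqnorm z)) * eta z.1).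
Proof.
rewrite (_ : (fun z => _) = (fun z => 2 * z.2 ord0 i) *
    ((h1 \o sqnorm) * (fun z => eta z.1))).
  have D1 := is_derive_comp1 (is_derive_sqnorm_ex i z) (h1D (sqnorm_ge0 z)).
  have D2 := is_derive_time_ex eta i z.
  have D3 : is_derive z (ex i) (fun z => 2 * z.2 ord0 i) 2.
    rewrite (_ : (fun z => _) = (2 : R) \*: (fun z : spacetime => z.2 ord0 i))//.
    have D4 := is_derive_coord i (ex i) z.
    by apply: is_derive_eq; rewrite mxE !eqxx [LHS]mulr1.
  by apply: is_derive_eq; rewrite /GRing.scale /= !fctE /=; ring.
apply/funext => z'; case: (is_derive_radial_ex i z') => _ ->.
by rewrite -[RHS]mulrA -!mulrA.
Qed.

Lemma laplacian_radial z : laplacian f z =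
  (4 * sqnorm z * h2 (sqnorm z) + 2 * N%:R * h1 (sqnorm z)) * eta z.1.
Proof.
rewrite /laplacian.
under eq_bigr => i _ do case: (is_derive2_radial_ex i z) => _ ->.
rewrite -mulr_suml big_split /= sumr_const card_ord -mulr_suml -mulr_sumr.
by rewrite -/(sqnorm z) -mulr_natr; congr (_ * _); ring.
Qed.

End radial_mul.
End radial.

(** * The cutoff function and bounds on its derivatives *)

Section cutoff.
Context {R : realType} {N : nat}.
Local Notation spacetime := (R * 'rV[R]_N)%type.
Implicit Types (z e : spacetime).
Variables (n : nat) (rho tau : R).
Hypotheses (rho0 : 0 < rho) (tau0 : 0 < tau).

Definition parabola_x z : R := 1 - rho ^- 2 * sqnorm z.
(** Centre 2 tau and half-width tau keep the support in [tau, 3 tau], away from t = 0. *)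
Definition parabola_t (t : R) : R := 1 - tau ^- 2 * (t - 2 * tau) ^+ 2.
(** The exponent is at least 3 so that the cutoff is twice continuously differentiable; [n] is left
    free to be taken large in Young's inequality. *)
Definition cutoff z : R := pos_pow n.+3 (parabola_x z) * pos_pow n.+3 (parabola_t z.1).
Definition cutoff_base z : R := Num.max (parabola_x z) 0 * Num.max (parabola_t z.1) 0.

Definition cutoff_box : set spacetime :=
  `[tau, 3 * tau]%classic `*` box (const_mx (- rho)) (const_mx rho).

Lemma cutoffE z : cutoff z = cutoff_base z ^+ n.+3.
Proof. by rewrite exprMn. Qed.

Lemma parabola_x_le1 z : Num.max (parabola_x z) 0 <= 1.
Proof.
rewrite ge_max ler01 andbT lerBlDr lerDl mulr_ge0 ?sqnorm_ge0//.
by rewrite invr_ge0 exprn_ge0 ?ltW.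
Qed.

Lemma parabola_t_le1 t : Num.max (parabola_t t) 0 <= 1.
Proof.
rewrite ge_max ler01 andbT lerBlDr lerDl mulr_ge0 ?sqr_ge0//.
by rewrite invr_ge0 exprn_ge0 ?ltW.
Qed.

Lemma cutoff_base_ge0 z : 0 <= cutoff_base z.
Proof. by rewrite mulr_ge0// le_max lexx orbT. Qed.

Lemma cutoff_base_le1 z : cutoff_base z <= 1.
Proof.
by rewrite mulr_ile1 ?parabola_x_le1 ?parabola_t_le1// le_max lexx orbT.
Qed.

Lemma parabola_x_gt0 z : 0 < parabola_x z -> sqnorm z < rho ^+ 2.
Proof. by rewrite subr_gt0 mulrC ltr_pdivrMr ?exprn_gt0// mul1r. Qed.

Lemma parabola_t_gt0 t : 0 < parabola_t t -> `|t - 2 * tau| < tau.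
Proof.
rewrite subr_gt0 mulrC ltr_pdivrMr ?exprn_gt0// mul1r -real_normK ?num_real//.
by rewrite ltr_pXn2r// nnegrE// ltW.
Qed.

Lemma cutoff_base_support z : cutoff_base z != 0 -> cutoff_box z.
Proof.
move=> P0.
have x0 : 0 < parabola_x z.
  rewrite ltNge; apply: contra P0 => h; rewrite /cutoff_base max_r//.
  by rewrite mul0r.
have t0 : 0 < parabola_t z.1.
  rewrite ltNge; apply: contra P0 => h; rewrite /cutoff_base [X in _ * X]max_r//.
  by rewrite mulr0.
split => /=.
  have := parabola_t_gt0 t0; rewrite in_itv/= ltr_norml => /andP[] ? ?.
  by apply/andP; split; lra.
move=> i; rewrite !mxE in_itv/= -ler_norml.
have : z.2 ord0 i ^+ 2 <= rho ^+ 2.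
  apply: le_trans (ltW (parabola_x_gt0 x0)); rewrite /sqnorm (bigD1 i)//= lerDl.
  by apply: sumr_ge0 => j _; exact: sqr_ge0.
by rewrite -real_normK ?num_real// ler_pXn2r// nnegrE// ltW.
Qed.

Lemma compact_cutoff_box : compact cutoff_box.
Proof.
apply: compact_setX; first exact: segment_compact.
apply: (@rV_compact _ _ (fun i => `[const_mx (- rho) (ord0 : 'I_1) i,
                                    const_mx rho (ord0 : 'I_1) i]%classic)).
by move=> i; exact: segment_compact.
Qed.

Lemma cutoff_box_Q : cutoff_box `<=` Q.
Proof. by move=> z [/= + _]; rewrite in_itv/= => /andP[+ _]; exact: lt_le_trans. Qed.

Lemma Cc2_cutoff : Cc2 cutoff.
Proof.
split.
  rewrite (_ : cutoff = (pos_pow n.+3 \o parabola_x) *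
     (pos_pow n.+3 \o (fun z => parabola_t z.1)))//.
  apply: CkM; apply: (@Ck_pos_pow _ _ 2 n).
    rewrite (_ : parabola_x = cst 1 + cst (- rho ^- 2) * sqnorm).
      by apply: CkD; [exact: Ck_cst|apply: CkM; [exact: Ck_cst|exact: Ck_sqnorm]].
    by apply/funext => z; rewrite /parabola_x fctE /= mulNr.
  rewrite (_ : (fun z => _) = cst 1 + cst (- tau ^- 2) *
    (((fun z => z.1) + cst (- (2 * tau))) * ((fun z => z.1) + cst (- (2 * tau))))).
    apply: CkD; [exact: Ck_cst|apply: CkM; first exact: Ck_cst].
    by apply: CkM; apply: CkD; (exact: Ck_cst || exact: Ck_fst).
  by apply/funext => z; rewrite /parabola_t fctE /= expr2 mulNr.
exists cutoff_box; split; [exact: compact_cutoff_box|exact: cutoff_box_Q|].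
move=> z zK; apply/eqP; rewrite cutoffE expf_eq0/=; apply/negPn/negP.
by move=> /cutoff_base_support; exact: zK.
Qed.

Let max_ge0 (s : R) : 0 <= Num.max s 0.
Proof. by rewrite le_max lexx orbT. Qed.

Lemma is_derive_parabola_t (t : R) :
  is_derive t 1 parabola_t (- (2 * tau ^- 2 * (t - 2 * tau))).
Proof.
rewrite (_ : parabola_t = cst 1 - tau ^- 2 \*: ((id - cst (2 * tau)) ^+ 2))//.
by apply: is_derive_eq; rewrite /GRing.scale /= !fctE /=; ring.
Qed.

(** Where the cutoff is positive, |t - 2 tau| < tau, so the time parabola has slope at most 2/tau.
    Only one power is lost; the bound gives up a second one in order to share the exponent [n.+1]
    with the Laplacian. *)
Lemma dt_cutoff_le z : `|dt 1 cutoff z| <= 2 * n.+3%:R / tau * cutoff_base z ^+ n.+1.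
Proof.
set m := n.+3.
have -> : dt 1 cutoff z = pos_pow m (parabola_x z) * (m%:R *
    pos_pow n.+2 (parabola_t z.1) * - (2 * tau ^- 2 * (z.1 - 2 * tau))).
  have Dx : is_derive z et (pos_pow m \o parabola_x)
      (m%:R * pos_pow n.+2 (parabola_x z) * 0).
    apply: is_derive_comp1; last exact: is_derive_pos_pow.
    rewrite (_ : parabola_x = cst 1 - rho ^- 2 \*: sqnorm)//.
    have Ds := is_derive_sqnorm_et z.
    by apply: is_derive_eq; rewrite scaler0 subr0.
  have Dt : is_derive z et (fun z => pos_pow m (parabola_t z.1))
      (m%:R * pos_pow n.+2 (parabola_t z.1) * - (2 * tau ^- 2 * (z.1 - 2 * tau))).
    apply: (@is_derive_affine _ _ _ _ (fun z : spacetime => z.1) _ 1 _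
      (pos_pow m \o parabola_t)) => //.
    exact: is_derive_comp1 (is_derive_parabola_t _) (is_derive_pos_pow _ _).
  have [_ D] : is_derive z et cutoff (pos_pow m (parabola_x z) * (m%:R *
    pos_pow n.+2 (parabola_t z.1) * - (2 * tau ^- 2 * (z.1 - 2 * tau)))).
    rewrite (_ : cutoff = (pos_pow m \o parabola_x) *
       (fun z => pos_pow m (parabola_t z.1)))//.
    by apply: is_derive_eq; rewrite mulr0 scaler0 addr0.
  by rewrite -D.
rewrite /cutoff_base /pos_pow exprMn; set a := Num.max (parabola_x z) 0.
(* Off the support both sides vanish, all exponents being positive. *)
have [b0|b0] := leP (parabola_t z.1) 0.
  by rewrite !expr0n/= !(mulr0,mul0r) normr0.
set b := parabola_t z.1 in b0 *.
have a0 : 0 <= a by exact: max_ge0.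
have a1 : a <= 1 by exact: parabola_x_le1.
have b1 : b <= 1 by have := parabola_t_le1 z.1; rewrite max_l// ltW.
have d1 := parabola_t_gt0 b0.
rewrite normrM [X in X * _]ger0_norm ?exprn_ge0// normrM normrN.
rewrite [X in _ * (X * _)]ger0_norm; last by rewrite mulr_ge0 ?exprn_ge0// ltW.
rewrite (_ : 2 * m%:R / tau * (a ^+ n.+1 * b ^+ n.+1) =
   a ^+ n.+1 * (m%:R * b ^+ n.+1 * (2 / tau))); last by ring.
have an k : 0 <= a ^+ k by exact: exprn_ge0.
have bn k : 0 <= b ^+ k by exact/exprn_ge0/ltW.
apply: ler_pM => //; first by rewrite mulr_ge0// mulr_ge0.
  by apply: ler_wiXn2l => //; exact: leqW (leqnSn _).
apply: ler_pM => //; first by rewrite mulr_ge0.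
  by rewrite ler_wpM2l// ler_wiXn2l// ltW.
rewrite normrM ger0_norm; last by rewrite mulr_ge0 ?invr_ge0 ?exprn_ge0// ltW.
rewrite -mulrA ler_wpM2l// mulrC ler_pdivrMr ?exprn_gt0// (expr2 tau) mulKf ?gt_eqF//.
exact: ltW.
Qed.

(** The radial formula 4 s h'' + 2 N h' applies to h(s) = (1 - c s)_+^(n+3) with c = rho^-2. The
    second derivative carries c^2, but c s <= 1 on the support, so both terms are of order c. *)
Lemma laplacian_cutoff_le z : `|laplacian cutoff z| <=
  (4 * n.+3%:R * n.+2%:R + 2 * N%:R * n.+3%:R) / rho ^+ 2 * cutoff_base z ^+ n.+1.
Proof.
pose c := rho ^- 2; have c0 : 0 < c by rewrite invr_gt0 exprn_gt0.
have Dl (s : R) : is_derive s 1 (fun s => 1 - c * s) (- c).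
  rewrite (_ : (fun s => _) = cst 1 - c \*: id)//.
  by apply: is_derive_eq; rewrite sub0r [c *: 1]mulr1.
pose h s := pos_pow n.+3 (1 - c * s).
pose h1 s := n.+3%:R * pos_pow n.+2 (1 - c * s) * - c.
pose h2 s := n.+3%:R * n.+2%:R * pos_pow n.+1 (1 - c * s) * c ^+ 2.
have hD (s : R) : 0 <= s -> is_derive s 1 h (h1 s).
  by move=> _; apply: is_derive_comp1 (Dl s) (is_derive_pos_pow _ _).
have h1D (s : R) : 0 <= s -> is_derive s 1 h1 (h2 s).
  move=> _; have D := is_derive_comp1 (Dl s) (is_derive_pos_pow n _).
  rewrite (_ : h1 = (n.+3%:R * - c) \*: (pos_pow n.+2 \o (fun s => 1 - c * s))).
    by apply: is_derive_eq; rewrite /GRing.scale /= /h2; ring.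
  by apply/funext => t; rewrite /h1 /= /GRing.scale /=; ring.
rewrite (laplacian_radial (fun t => pos_pow n.+3 (parabola_t t)) hD h1D).
rewrite /h1 /h2 /cutoff_base /pos_pow exprMn -/(parabola_x z).
rewrite -[rho ^+ 2]invrK -/c invrK.
set b := Num.max (parabola_t z.1) 0.
have [a0|a0] := leP (parabola_x z) 0.
  by rewrite !expr0n/= !(mulr0,mul0r) addr0 mul0r normr0.
set a := parabola_x z in a0 *; set s := sqnorm z.
have s0 : 0 <= s by exact: sqnorm_ge0.
have b0 : 0 <= b by exact: max_ge0.
have b1 : b <= 1 by exact: parabola_t_le1.
have a1 : a <= 1 by have := parabola_x_le1 z; rewrite max_l// ltW.
have cs : c * s <= 1.
  by rewrite mulrC ler_pdivrMr ?exprn_gt0// mul1r; exact/ltW/parabola_x_gt0.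
rewrite normrM [X in _ * X]ger0_norm ?exprn_ge0//.
have am0 k : 0 <= a ^+ k by rewrite exprn_ge0// ltW.
rewrite [leRHS]mulrA; apply: ler_pM => //; [exact: exprn_ge0| |]; last first.
  by apply: ler_wiXn2l => //; exact: leqW (leqnSn _).
set X := 4 * n.+3%:R * n.+2%:R; set Y := 2 * N%:R * n.+3%:R.
rewrite [leRHS](_ : _ = X * c * a ^+ n.+1 + Y * c * a ^+ n.+1); last by ring.
have [X0 Y0] : 0 <= X /\ 0 <= Y by rewrite /X /Y; split; rewrite !mulr_ge0.
apply: le_trans (ler_normD _ _) _; apply: lerD.
  rewrite (_ : 4 * s * _ = X * c * a ^+ n.+1 * (c * s)); last by rewrite /X; ring.
  rewrite ger0_norm; first by rewrite ler_piMr// mulr_ge0// mulr_ge0// ltW.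
  by rewrite mulr_ge0// mulr_ge0// ?mulr_ge0// ltW.
rewrite (_ : 2 * N%:R * _ = - (Y * c * a ^+ n.+2)); last by rewrite /Y; ring.
rewrite normrN ger0_norm; last by rewrite mulr_ge0// mulr_ge0// ltW.
by rewrite ler_wpM2l ?mulr_ge0 ?(ltW c0)// ler_wiXn2l// ltW.
Qed.

End cutoff.

(** * Measurability and integrability on [Q] *)

Section spacetime_integrals.
Context {R : realType} {N : nat}.
Local Notation spacetime := (R * 'rV[R]_N)%type.
Local Notation mspacetime := (measurableTypeR R * 'rV[R]_N)%type.
Implicit Types (f phi : spacetime -> R) (z : spacetime) (K : set spacetime).

Lemma measurable_Q : measurable (Q : set mspacetime).
Proof.
rewrite (_ : Q = `]0, +oo[%classic `*` setT).
  by apply: measurableX => //; exact: measurable_itv.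
by apply/seteqP; split=> z; rewrite /Q /= in_itv/= andbT //; case.
Qed.

Lemma compact_measurable_tx K : compact K -> measurable (K : set mspacetime).
Proof.
move=> cK; have clK : closed K by apply: compact_closed cK; exact: norm_hausdorff.
rewrite -[K]setCK; apply: measurableC; apply: open_measurable_tx.
exact: closed_openC clK.
Qed.

Lemma compact_continuous_bound K f : compact K -> continuous f ->
  exists2 G : R, 0 <= G & forall z, K z -> `|f z| <= G.
Proof.
move=> cK cf.
have /compact_bounded[M [_ HM]] : compact (f @` K).
  by apply: continuous_compact cK; exact: continuous_subspaceT.
exists (`|M| + 1); first by rewrite addr_ge0.
by move=> z Kz; apply: HM; [have := ler_norm M; lra|exists z].
Qed.

Lemma Cc2_continuous_dt phi : Ck 2 phi -> continuous (dt 1 phi).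
Proof.
move=> [_ H]; have [_] := H et (or_introl erefl).
exact: (@Ck_continuous _ _ 1).
Qed.

Lemma Cc2_continuous_laplacian phi : Ck 2 phi -> continuous (laplacian phi).
Proof.
move=> [_ H]; rewrite (_ : laplacian phi =
    \sum_(i < N) (fun z => 'D_(ex i) (fun z' => 'D_(ex i) phi z') z)).
  apply: (@Ck_continuous _ _ 0); apply: Ck_sum => i.
  have he : ex i = et :> spacetime \/ exists j, ex i = ex j :> spacetime.
    by right; exists i.
  by have [_ [_ /(_ _ he) [_ ?]]] := H _ he.
by apply/funext => z; rewrite /laplacian fct_sumE.
Qed.

Lemma integrable_widen (B D : set mspacetime) f :
  measurable B -> measurable D -> B `<=` D ->
  (forall z, D z -> ~ B z -> f z = 0) ->
  lebesgue_tx.-integrable B (EFin \o f) ->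
  lebesgue_tx.-integrable D (EFin \o f).
Proof.
move=> mB mD BD f0 /(integrable_mkcond _ mB) fB; apply/integrable_mkcond => //.
rewrite (_ : _ \_ _ = (EFin \o f) \_ B)//; apply/funext => z; rewrite !patchE.
have [/set_mem Bz|/negP Bz] := boolP (z \in B).
  by rewrite mem_set//; exact: BD.
case: ifPn => // /set_mem Dz; rewrite /= f0// => Bz'; apply: Bz; exact/mem_set.
Qed.

Lemma Rintegral_indic_tx (B D : set mspacetime) : measurable B -> measurable D ->
  B `<=` D -> \int[lebesgue_tx]_(z in D) (\1_B z) = fine (lebesgue_tx B).
Proof.
by move=> mB mD BD; rewrite /Rintegral integral_indic// setIidl.
Qed.

Lemma integrable_indic_tx (B D : set mspacetime) : measurable B -> measurable D ->
  B `<=` D -> (lebesgue_tx B < +oo)%E ->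
  lebesgue_tx.-integrable D (EFin \o \1_B).
Proof.
move=> mB mD BD Boo; apply: (@integrable_widen B) => //.
  by move=> z _ Bz; rewrite indicE memNset.
apply: measurable_bounded_integrable => //.
exists 1; split => // x x1 z _ /=; rewrite indicE; case: (_ \in _) => /=;
  rewrite ?normr1 ?normr0; lra.
Qed.

End spacetime_integrals.

(** Since 0 <= P <= 1, the condition on [n] gives P^(n+1) <= P^((n+3)/r), whose r-th power is
    P^(n+3). Young's inequality for the exponents r and r/(r-1) then applies to X P^((n+3)/r) and
    K. *)
Lemma young_cutoff (R : realType) (n : nat) (r X K P : R) :
  1 < r -> n.+3%:R / r <= n.+1%:R :> R -> 0 <= X -> 0 <= K -> 0 <= P <= 1 ->
  X * (K * P ^+ n.+1) <= X `^ r * P ^+ n.+3 + K `^ (r / (r - 1)).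
Proof.
move=> r1 rn X0 K0 /andP[P0 P1].
have r0 : 0 < r by lra.
have r10 : 0 < r - 1 by lra.
set P' := P `^ (n.+3%:R / r).
have P'0 : 0 <= P' by exact: powR_ge0.
have PP' : P ^+ n.+1 <= P'.
  (* Monotonicity in the exponent is used for a positive base, so P = 0 is treated apart. *)
  have [->|Pn0] := eqVneq P 0; first by rewrite expr0n powR_ge0.
  by rewrite -powR_mulrn// ger_powR// P1 lt_neqAle eq_sym Pn0 P0.
have -> : X `^ r * P ^+ n.+3 = (X * P') `^ r.
  by rewrite powRM// -powRrM divfK ?gt_eqF// powR_mulrn.
apply: (@le_trans _ _ ((X * P') * K)).
  by rewrite -mulrA [P' * K]mulrC !ler_wpM2l.
have s0 : 0 < r / (r - 1) by rewrite divr_gt0.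
have s1 : 1 <= r / (r - 1) by rewrite ler_pdivlMr// mul1r; lra.
apply: le_trans (conjugate_powR _ K0 r0 s0 _) _; first exact: mulr_ge0.
  by rewrite invf_div -[X in X + _]mul1r -mulrDl addrC subrK divff// gt_eqF.
(* The weights 1/r and (r-1)/r of Young's inequality are at most 1 and are dropped. *)
by apply: lerD; rewrite ler_pdivrMr ?ler_peMr ?powR_ge0// ltW.
Qed.

(** * Testing a weak solution against the cutoff *)

Section nonexistence.
Context {R : realType} {N : nat}.
Local Notation spacetime := (R * 'rV[R]_N)%type.
Local Notation mspacetime := (measurableTypeR R * 'rV[R]_N)%type.
Variables (k : nat) (p q : R) (g : 'rV[R]_N -> R) (u v : spacetime -> R).
Hypotheses (p1 : 1 < p) (q1 : 1 < q) (cg : continuous g)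
  (g0 : forall x, 0 <= g x).
Hypothesis ws : weak_solution k p q (fun z => g z.2) u v.
Variables (n : nat) (rho tau : R).
Hypotheses (np : n.+3%:R / p <= n.+1%:R :> R) (nq : n.+3%:R / q <= n.+1%:R :> R).
Hypotheses (rho0 : 0 < rho) (tau0 : 0 < tau).

Let Kx : R := (4 * n.+3%:R * n.+2%:R + 2 * N%:R * n.+3%:R) / rho ^+ 2.
Let Kt : R := 2 * n.+3%:R / tau.
Let phi : spacetime -> R := cutoff n rho tau.
Let P : spacetime -> R := cutoff_base rho tau.
Let B : set mspacetime := cutoff_box rho tau.

Let Kx0 : 0 <= Kx.
Proof. by rewrite /Kx divr_ge0 ?sqr_ge0// addr_ge0// mulr_ge0// mulr_ge0. Qed.

Let Kt0 : 0 <= Kt. Proof. by rewrite /Kt divr_ge0 ?(ltW tau0)// mulr_ge0. Qed.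

Let P01 z : 0 <= P z <= 1.
Proof. by rewrite cutoff_base_ge0 cutoff_base_le1. Qed.

Let PB z : ~ B z -> P z = 0.
Proof.
by move=> Bz; apply/eqP/negPn/negP => /(cutoff_base_support rho0 tau0).
Qed.

Let phi01 z : 0 <= phi z <= 1.
Proof.
have /andP[h0 h1] := P01 z.
by rewrite /phi cutoffE exprn_ge0//= exprn_ile1.
Qed.

Let Ex := Kx `^ (p / (p - 1)).
Let Et := Kt `^ (q / (q - 1)).

Let u_lap_le z : `|u z * laplacian phi z| <= `|u z| `^ p * phi z + Ex.
Proof.
rewrite normrM /phi cutoffE; apply: le_trans (young_cutoff p1 np _ Kx0 (P01 z)) => //.
by rewrite ler_wpM2l// laplacian_cutoff_le.
Qed.

Let v_dt_le z : `|v z * dt 1 phi z| <= `|v z| `^ q * phi z + Et.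
Proof.
rewrite normrM /phi cutoffE; apply: le_trans (young_cutoff q1 nq _ Kt0 (P01 z)) => //.
by rewrite ler_wpM2l// dt_cutoff_le.
Qed.

Let mQ := @measurable_Q R N.
Let cB : compact B. Proof. exact: compact_cutoff_box. Qed.
Let mB : measurable B. Proof. exact: compact_measurable_tx. Qed.
Let BQ : B `<=` Q. Proof. exact: cutoff_box_Q. Qed.
Let muB : lebesgue_tx B = (2 * tau * (2 * rho) ^+ N)%:E.
Proof.
rewrite lebesgue_tx_box; first last.
- by move=> i; rewrite !mxE; rewrite (@le_trans _ _ 0)// ?oppr_le0 ltW.
- by rewrite ler_peMl ?(ltW tau0)// ler1n.
under eq_bigr do rewrite !mxE opprK.
by rewrite prodr_const card_ord; congr (_%:E); congr (_ * _); [ring|congr (_ ^+ _); ring].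
Qed.

Let Cphi : Cc2 phi. Proof. exact: Cc2_cutoff. Qed.
Let ctM (f : spacetime -> R) : continuous f ->
  measurable_fun (Q : set mspacetime) (f : mspacetime -> measurableTypeR R).
Proof. by move=> cf; apply: measurable_funTS; exact: continuous_measurable_tx. Qed.

Let mu_ : measurable_fun (Q : set mspacetime) (u : mspacetime -> measurableTypeR R).
Proof. by case: ws => -[]. Qed.

Let mv_ : measurable_fun (Q : set mspacetime) (v : mspacetime -> measurableTypeR R).
Proof. by case: ws => _ -[]. Qed.

Let pow_integrable (r : R) (f : spacetime -> R) : Lloc r f ->
  lebesgue_tx.-integrable B (EFin \o (fun z => `|f z| `^ r)).
Proof.
move=> [mf Hf]; apply/integrableP; split.
  apply/measurable_EFinP; apply: (measurableT_comp (@measurable_powR R r)).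
  by apply: measurableT_comp => //; exact: measurable_funS mf.
under eq_integral do rewrite /= ger0_norm ?powR_ge0//.
exact: Hf.
Qed.

(** The three integrands of the weak identity all live on the compact box [B] and are bounded there
    by |u|^p + |v|^q + c, which is integrable by the local integrability of [u] and [v]. *)
Let dominated_integrable (f : spacetime -> R) (c : R) :
  measurable_fun (Q : set mspacetime) (f : mspacetime -> measurableTypeR R) ->
  (forall z, ~ B z -> f z = 0) ->
  (forall z, B z -> `|f z| <= `|u z| `^ p + `|v z| `^ q + c) ->
  lebesgue_tx.-integrable (Q : set mspacetime) (EFin \o f).
Proof.
move=> mf f0 fle; apply: (@integrable_widen _ _ B) => // [z _ /f0//|].
have [Lu Lv _ _] := ws.
have intc : lebesgue_tx.-integrable B (EFin \o cst c).
  apply: measurable_bounded_integrable => //; first by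
    change (lebesgue_tx B < +oo)%E; rewrite muB ltry.
  by exists `|c|; split => // x cx z _ /=; exact: ltW.
have intD : lebesgue_tx.-integrable B
    (EFin \o (fun z => `|u z| `^ p + `|v z| `^ q + c)).
  have := integrableD mB (integrableD mB (pow_integrable Lu) (pow_integrable Lv)) intc.
  by apply: eq_integrable.
apply: le_integrable intD => //.
  by apply/measurable_EFinP; exact: measurable_funS mf.
by move=> z Bz /=; rewrite lee_fin (le_trans (fle _ Bz))// ler_norm.
Qed.

(** The weak identity says that [F1 + F2 + F3] has integral zero. By the two Young bounds this sum
    is at least g phi - (Ex + Et) on [B], hence at least c on [B0] minus Ex + Et on [B]; integrating
    gives the claim. *)
Lemma weak_solution_cutoff_le (B0 : set mspacetime) (c : R) :
  measurable B0 -> B0 `<=` B -> (forall z, B0 z -> c <= g z.2 * phi z) ->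
  c * fine (lebesgue_tx B0) <= (Ex + Et) * (2 * tau * (2 * rho) ^+ N).
Proof.
move=> mB0 B0B gc.
have cg2 : continuous (fun z : spacetime => g z.2).
  by move=> z; apply: (@continuous_comp _ _ _ snd g); [exact: cvg_snd|exact: cg].
have [G G0 HG] := compact_continuous_bound cB cg2.
have [_ _ _ /(_ _ Cphi)] := ws.
have [C2 _] := Cphi.
have phi0 z : ~ B z -> phi z = 0.
  by move=> /PB Pz; rewrite /phi cutoffE [cutoff_base _ _ _]Pz expr0n.
pose F1 z := (`|u z| `^ p + `|v z| `^ q + g z.2) * phi z.
pose F2 z := v z * dt 1 phi z.
pose F3 z := u z * laplacian phi z.
have Ex0 : 0 <= Ex by exact: powR_ge0.
have Et0 : 0 <= Et by exact: powR_ge0.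
have mphi : measurable_fun (Q : set mspacetime) (phi : mspacetime -> measurableTypeR R).
  by apply: ctM; exact: Ck_continuous C2.
have pow_phi (x : R) z : 0 <= x -> x * phi z <= x.
  by move=> x0; rewrite ler_piMr//; have /andP[] := phi01 z.
have I1 : lebesgue_tx.-integrable (Q : set mspacetime) (EFin \o F1).
  apply: (@dominated_integrable _ G).
  - apply: measurable_funM => //; apply: measurable_funD; last exact: ctM.
    apply: measurable_funD.
      apply: (measurableT_comp (@measurable_powR R p)).
      exact: measurableT_comp.
    apply: (measurableT_comp (@measurable_powR R q)).
    exact: measurableT_comp.
  - by move=> z /phi0; rewrite /F1 => ->; rewrite mulr0.
  - move=> z Bz; have h1 : 0 <= `|u z| `^ p + `|v z| `^ q + g z.2.
      by rewrite !addr_ge0// powR_ge0.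
    rewrite /F1 ger0_norm; last by rewrite mulr_ge0//; have /andP[] := phi01 z.
    apply: le_trans (pow_phi _ _ h1) _; rewrite lerD2l.
    exact: le_trans (ler_norm _) (HG _ Bz).
have F20 z : ~ B z -> F2 z = 0.
  move=> /PB Pz; have := dt_cutoff_le n rho0 tau0 z.
  rewrite [cutoff_base _ _ _]Pz expr0n mulr0 normr_le0 => /eqP.
  by rewrite /F2 => ->; rewrite mulr0.
have F30 z : ~ B z -> F3 z = 0.
  move=> /PB Pz; have := laplacian_cutoff_le n rho0 tau0 z.
  rewrite [cutoff_base _ _ _]Pz expr0n mulr0 normr_le0 => /eqP.
  by rewrite /F3 => ->; rewrite mulr0.
have I2 : lebesgue_tx.-integrable (Q : set mspacetime) (EFin \o F2).
  apply: (@dominated_integrable _ Et).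
  - by apply: measurable_funM => //; apply: ctM; exact: Cc2_continuous_dt.
  - exact: F20.
  - move=> z _; apply: le_trans (v_dt_le z) _; rewrite lerD2r.
    by apply: le_trans (pow_phi _ _ _) _; rewrite ?lerDr powR_ge0.
have I3 : lebesgue_tx.-integrable (Q : set mspacetime) (EFin \o F3).
  apply: (@dominated_integrable _ Ex).
  - by apply: measurable_funM => //; apply: ctM; exact: Cc2_continuous_laplacian.
  - exact: F30.
  - move=> z _; apply: le_trans (u_lap_le z) _; rewrite lerD2r.
    by apply: le_trans (pow_phi _ _ _) _; rewrite ?lerDl powR_ge0.
rewrite -/(Rintegral _ _ F1) -/(Rintegral _ _ F2) -/(Rintegral _ _ F3) => weq.
have I12 : lebesgue_tx.-integrable (Q : set mspacetime)
    (EFin \o (fun z => F1 z + F2 z)).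
  by apply: eq_integrable (integrableD mQ I1 I2).
have I123 : lebesgue_tx.-integrable (Q : set mspacetime)
    (EFin \o (fun z => F1 z + F2 z + F3 z)).
  by apply: eq_integrable (integrableD mQ I12 I3).
have S0 : \int[lebesgue_tx]_(z in Q) (F1 z + F2 z + F3 z) = 0.
  by rewrite !RintegralD// [X in X + _ + _]weq; ring.
have B0oo : (lebesgue_tx B0 < +oo)%E.
  apply: (@le_lt_trans _ _ (lebesgue_tx B)); last by rewrite muB ltry.
  by apply: le_measure; rewrite ?inE.
have Boo : (lebesgue_tx B < +oo)%E by rewrite muB ltry.
have B0Q : B0 `<=` Q by move=> z /B0B/BQ.
have i0 := integrable_indic_tx mB0 mQ B0Q B0oo.
have iB := integrable_indic_tx mB mQ BQ Boo.
have i0c : lebesgue_tx.-integrable (Q : set mspacetime)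
    (EFin \o (fun z => c * \1_B0 z)).
  by apply: eq_integrable (integrableZl mQ c i0).
have iBc : lebesgue_tx.-integrable (Q : set mspacetime)
    (EFin \o (fun z => (Ex + Et) * \1_B z)).
  by apply: eq_integrable (integrableZl mQ (Ex + Et) iB).
have : \int[lebesgue_tx]_(z in Q) (c * \1_B0 z - (Ex + Et) * \1_B z) <=
       \int[lebesgue_tx]_(z in Q) (F1 z + F2 z + F3 z).
  apply: le_Rintegral => //.
    by apply: eq_integrable (integrableB mQ i0c iBc).
  move=> z Qz.
  (* Outside [B] both sides of the pointwise inequality are zero. *)
  have [Bz|Bz] := pselect (B z); last first.
    rewrite !indicE !memNset//; last by move=> /B0B.
    by rewrite F20// F30// /F1 phi0// !mulr0 subr0 !addr0.
  rewrite [\1_B z]indicE mem_set// mulr1.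
  have h1 : c * \1_B0 z <= g z.2 * phi z.
    rewrite indicE; have [/set_mem/gc h|_] := boolP (z \in B0); first by rewrite mulr1.
    by rewrite mulr0 mulr_ge0//; have /andP[] := phi01 z.
  have := u_lap_le z; have := v_dt_le z; rewrite -/(F2 z) -/(F3 z) !ler_norml.
  move=> /andP[h2 _] /andP[h3 _].
  rewrite /F1 !mulrDl lerBlDr; apply: le_trans h1 _.
  (* The slack is exactly the sum of the slacks in the two Young bounds: the terms |u|^p phi and
     |v|^q phi cancel. *)
  rewrite -subr_ge0 in h2; rewrite -subr_ge0 in h3; rewrite -subr_ge0.
  by apply: le_trans (addr_ge0 h2 h3) _; rewrite le_eqVlt; apply/predU1P; left; ring.
rewrite S0 RintegralB// RintegralZl// RintegralZl// !Rintegral_indic_tx//.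
by rewrite muB subr_le0.
Qed.

End nonexistence.

(** * A sub-box on which the cutoff and the source are bounded below *)

Section inner_box.
Context {R : realType} {N : nat}.
Local Notation spacetime := (R * 'rV[R]_N)%type.
Local Notation mspacetime := (measurableTypeR R * 'rV[R]_N)%type.
Variables (n : nat) (rho tau : R).
Hypotheses (N0 : (0 < N)%N) (rho0 : 0 < rho) (tau0 : 0 < tau).

(** A box off the origin, so that |x| is of order rho throughout, filling a proportion of
    [cutoff_box] that depends on [N] alone. *)
Definition inner_box : set mspacetime :=
  `[3 / 2 * tau, 5 / 2 * tau]%classic `*`
  box (const_mx (rho / (4 * N%:R))) (const_mx (rho / (2 * N%:R))).

Let NR : 1 <= N%:R :> R. Proof. by rewrite ler1n. Qed.

Let rhoN : 0 < rho / (4 * N%:R).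
Proof. by rewrite divr_gt0// mulr_gt0// ltr0n. Qed.

Let rhoN2 : rho / (2 * N%:R) = 2 * (rho / (4 * N%:R)).
Proof. by field; rewrite pnatr_eq0 -lt0n. Qed.

Lemma lebesgue_inner_box :
  lebesgue_tx inner_box = (tau * (rho / (4 * N%:R)) ^+ N)%:E.
Proof.
have d0 := rhoN; have t0 := tau0; rewrite lebesgue_tx_box; [|lra|]; last first.
  by move=> i; rewrite !mxE rhoN2; lra.
under eq_bigr do rewrite !mxE rhoN2.
rewrite prodr_const card_ord; congr (_%:E); congr (_ * _); first lra.
by congr (_ ^+ _); lra.
Qed.

Lemma measurable_inner_box : measurable inner_box.
Proof. by apply: measurableX; [exact: measurable_itv|exact: measurable_box]. Qed.

(** One coordinate gives the lower bound; summing N squares of size at most (rho/(2N))^2 gives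
    rho^2/(4N), hence the upper one. *)
Lemma inner_box_sqnorm (z : spacetime) : inner_box z ->
  (rho / (4 * N%:R)) ^+ 2 <= sqnorm z <= rho ^+ 2 / 4.
Proof.
move=> [_ Hz]; have d0 := rhoN.
have Hi i : rho / (4 * N%:R) <= z.2 ord0 i <= 2 * (rho / (4 * N%:R)).
  by have := Hz i; rewrite !mxE rhoN2 in_itv.
apply/andP; split.
  rewrite /sqnorm (bigD1 (Ordinal N0))//=.
  apply: (@le_trans _ _ (z.2 ord0 (Ordinal N0) ^+ 2)).
    by have /andP[h _] := Hi (Ordinal N0); rewrite lerXn2r// nnegrE; lra.
  by rewrite lerDl sumr_ge0// => i _; exact: sqr_ge0.
apply: (@le_trans _ _ (\sum_(i < N) (2 * (rho / (4 * N%:R))) ^+ 2)).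
  by apply: ler_sum => i _; have /andP[h1 h2] := Hi i; rewrite lerXn2r// nnegrE; lra.
rewrite sumr_const card_ord -[_ *+ N]mulr_natr.
rewrite (_ : _ * N%:R = rho ^+ 2 / 4 / N%:R); last first.
  by field; rewrite pnatr_eq0 -lt0n.
by rewrite ler_pdivrMr ?ltr0n// ler_peMr// divr_ge0// sqr_ge0.
Qed.

(** Each parabola is at least 3/4 on the inner box, and 9/16 >= 1/4. *)
Lemma inner_box_cutoff_base (z : spacetime) : inner_box z ->
  4^-1 <= cutoff_base rho tau z.
Proof.
move=> Bz; have /andP[_ s4] := inner_box_sqnorm Bz.
have [/= + _] := Bz; rewrite in_itv/= => /andP[t1 t2].
have t0 := tau0; have r2 : 0 < rho ^+ 2 by rewrite exprn_gt0.
have t20 : 0 < tau ^+ 2 by rewrite exprn_gt0.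
have hx : 3 / 4 <= parabola_x rho z.
  rewrite /parabola_x lerBrDl -lerBrDr mulrC ler_pdivrMr//.
  by apply: le_trans s4 _; lra.
have ht : 3 / 4 <= parabola_t tau z.1.
  rewrite /parabola_t lerBrDl -lerBrDr mulrC ler_pdivrMr//.
  have : `|z.1 - 2 * tau| <= tau / 2 by rewrite ler_norml; apply/andP; split; lra.
  rewrite -(@ler_pXn2r _ 2)// ?nnegrE ?normr_ge0//; last by lra.
  by rewrite real_normK ?num_real// expr_div_n; lra.
rewrite /cutoff_base !max_l; [|lra|lra].
apply: (@le_trans _ _ (3 / 4 * (3 / 4))); first lra.
by apply: ler_pM => //; lra.
Qed.

Lemma inner_box_cutoff_box : inner_box `<=` cutoff_box rho tau.
Proof.
move=> z Bz; apply: cutoff_base_support => //.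
by rewrite gt_eqF//; apply: lt_le_trans (inner_box_cutoff_base Bz); rewrite invr_gt0.
Qed.

(** On the inner box 1 <= |x| <= rho: the first inequality lets the exponent -a be lowered to -b,
    the second replaces |x| by rho because b >= 0. *)
Lemma inner_box_Ia_ge (a b C M : R) (g : 'rV[R]_N -> R) (z : spacetime) :
  a <= b -> 0 <= b -> 0 < C -> 1 <= rho / (4 * N%:R) -> M <= rho / (4 * N%:R) ->
  (forall x, M <= enorm x -> C * enorm x `^ (- a) <= g x) ->
  inner_box z -> C * rho `^ (- b) * 4^-1 ^+ n.+3 <= g z.2 * cutoff n rho tau z.
Proof.
move=> ab b0 C0 rho1 rhoM Hg Bz.
have /andP[s1 s2] := inner_box_sqnorm Bz.
have e1 : rho / (4 * N%:R) <= enorm z.2.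
  rewrite -(@ler_pXn2r _ 2)// ?nnegrE ?sqrtr_ge0 ?(ltW rhoN)//.
  by rewrite sqr_sqrtr//; exact: sqnorm_ge0.
have e2 : enorm z.2 <= rho.
  rewrite -(@ler_pXn2r _ 2)// ?nnegrE ?sqrtr_ge0 ?(ltW rho0)//.
  rewrite sqr_sqrtr; last exact: sqnorm_ge0.
  by apply: le_trans s2 _; rewrite ler_pdivrMr// ler_peMr ?sqr_ge0// ler1n.
have e0 : 0 < enorm z.2 by exact: lt_le_trans e1.
apply: ler_pM; first by rewrite mulr_ge0 ?powR_ge0 ?(ltW C0).
- by apply: exprn_ge0; rewrite invr_ge0.
- apply: le_trans (Hg _ (le_trans rhoM e1)); rewrite ler_wpM2l ?(ltW C0)//.
  apply: (@le_trans _ _ (enorm z.2 `^ (- b))).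
    rewrite !powRN lef_pV2 ?posrE ?powR_gt0//.
    by apply: ge0_ler_powR => //; rewrite nnegrE ltW.
  by rewrite ler_powR ?lerN2// (le_trans rho1).
- rewrite cutoffE lerXn2r ?nnegrE ?invr_ge0 ?cutoff_base_ge0//.
  exact: inner_box_cutoff_base.
Qed.

End inner_box.

(** * Nonexistence: letting rho grow *)

Section no_weak_solution.
Context {R : realType} {N : nat}.

(** The claim amounts to n (r - 1) >= 3 - r, and 3 - r < 2 <= n (r - 1). *)
Lemma conj_exponent_nat (r : R) (n : nat) : 1 < r -> 2 / (r - 1) <= n%:R ->
  n.+3%:R / r <= n.+1%:R :> R.
Proof.
move=> r1; rewrite ler_pdivrMr ?subr_gt0// => h.
rewrite ler_pdivrMr; last lra.
have -> : n.+3%:R = n%:R + 3 :> R by rewrite -!natr1; ring.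
have -> : n.+1%:R = n%:R + 1 :> R by rewrite -natr1.
rewrite mulrDl mul1r; have : n%:R * (r - 1) = n%:R * r - n%:R by ring.
lra.
Qed.

Lemma no_weak_solution (k : nat) (p q a : R) (g : 'rV[R]_N -> R) :
  (0 < N)%N -> 1 < p -> 1 < q -> a < 2 * p / (p - 1) -> Ia a g ->
  ~ exists u v, weak_solution k p q (fun z => g z.2) u v.
Proof.
move=> N0 p1 q1 alt [cg g0 [C [M [C0 Hg]]]] [u [v ws]].
have p10 : 0 < p - 1 by lra.
have q10 : 0 < q - 1 by lra.
pose p' := p / (p - 1); pose q' := q / (q - 1).
have p'1 : 1 < p' by rewrite ltr_pdivlMr// mul1r; lra.
have q'0 : 0 < q' by rewrite divr_gt0//; lra.
(* Replacing [a] by [b] covers negative [a]; it stays below 2p' because p' > 1. *)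
pose b := Num.max a 1.
have ab : a <= b by rewrite le_max lexx.
have b0 : 0 <= b by rewrite le_max ler01 orbT.
have bp : b < 2 * p' by rewrite gt_max -mulrA in alt *; rewrite alt/=; lra.
have [n [np nq]] : exists n, n.+3%:R / p <= n.+1%:R :> R /\
    n.+3%:R / q <= n.+1%:R :> R.
  exists (Num.truncn (Num.max (2 / (p - 1)) (2 / (q - 1)))).+1.
  have := ltW (truncnS_gt (Num.max (2 / (p - 1)) (2 / (q - 1)))).
  by rewrite ge_max => /andP[hp hq]; split; exact: conj_exponent_nat.
pose Ax : R := 4 * n.+3%:R * n.+2%:R + 2 * N%:R * n.+3%:R.
pose At : R := 2 * n.+3%:R.
have Ax0 : 0 < Ax by rewrite ltr_wpDr ?mulr_gt0 ?mulr_ge0.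
have At0 : 0 < At by rewrite mulr_gt0.
have NR : 0 < N%:R :> R by rewrite ltr0n.
(* Volume ratio 2 tau (2 rho)^N / (tau (rho/(4N))^N) = 2 (8N)^N of the two boxes, times the loss
   4^(n+3) from the lower bound on the cutoff. *)
pose D0 : R := 2 * (8 * N%:R) ^+ N * 4 ^+ n.+3.
have D00 : 0 < D0 
  by rewrite /D0 mulr_gt0 ?exprn_gt0// mulr_gt0 ?exprn_gt0// mulr_gt0.
have main rho : 4 * N%:R * Num.max M 1 <= rho -> 0 < rho ->
    C * rho `^ (- b) <= 2 * (Ax / rho ^+ 2) `^ p' * D0.
  rewrite mulrC -ler_pdivlMr ?mulr_gt0// ge_max => /andP[rM r1] rho0.
  pose Ex := (Ax / rho ^+ 2) `^ p'.
  have Ex0 : 0 < Ex by rewrite powR_gt0// divr_gt0// exprn_gt0.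
  (* This [tau] makes the error from the time derivative equal to the error [Ex] from the Laplacian;
     their sum is the factor 2 [Ex] in [main]. *)
  pose tau := At / Ex `^ (q'^-1).
  have tau0 : 0 < tau by rewrite divr_gt0// powR_gt0.
  have Et : (At / tau) `^ q' = Ex.
    rewrite /tau invf_div mulrC divfK ?gt_eqF//.
    by rewrite -powRrM mulVf ?gt_eqF// powRr1// ltW.
  have := weak_solution_cutoff_le p1 q1 cg g0 ws np nq rho0 tau0
    (measurable_inner_box rho tau) (inner_box_cutoff_box N0 rho0 tau0)
    (fun z => inner_box_Ia_ge n N0 rho0 tau0 ab b0 C0 r1 rM Hg (z := z)).
  rewrite lebesgue_inner_box// [fine _]/=.
  rewrite -/Ax -/At -/p' -/q' Et -/Ex => H.
  set d := rho / (4 * N%:R) in H r1 rM.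
  have d0 : 0 < d ^+ N by rewrite exprn_gt0// (lt_le_trans _ r1).
  have E4 : 0 < 4 ^+ n.+3 :> R by rewrite exprn_gt0.
  have rd : 2 * rho = 8 * N%:R * d by rewrite /d; field; rewrite gt_eqF.
  rewrite rd (exprMn _ (8 * N%:R)) exprVn in H.
  rewrite -(@ler_pM2r _ ((4 ^+ n.+3)^-1 * (tau * d ^+ N))); last first.
    by rewrite mulr_gt0 ?invr_gt0// mulr_gt0.
  rewrite mulrA; apply: le_trans H _; rewrite le_eqVlt; apply/orP; left; apply/eqP.
  by rewrite /D0; field; rewrite gt_eqF.
(* Multiplying [main] by rho^(2p')/C turns it into rho^del <= D1 with del > 0. *)
pose del := 2 * p' - b.
have del0 : 0 < del by rewrite subr_gt0.
pose D1 := 2 * Ax `^ p' * D0 / C.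
have D10 : 0 < D1 by rewrite divr_gt0// mulr_gt0// mulr_gt0// powR_gt0.
(* Large enough for [main], and with rho^del >= D1 + 1, which contradicts that bound. *)
pose rho := Num.max (4 * N%:R * Num.max M 1) ((D1 + 1) `^ del^-1).
have rho0 : 0 < rho by rewrite lt_max powR_gt0 ?orbT// ltr_wpDl// ltW.
have rho1 : 4 * N%:R * Num.max M 1 <= rho by rewrite le_max lexx.
have := main _ rho1 rho0.
have -> : (Ax / rho ^+ 2) `^ p' = Ax `^ p' * rho `^ (- (2 * p')).
  rewrite powRM ?(ltW Ax0) ?invr_ge0 ?sqr_ge0//; congr (_ * _).
  by rewrite -powR_invn ?(ltW rho0)// -powRrM mulNr.
apply/negP; rewrite -ltNge.
rewrite -(@ltr_pM2r _ (rho `^ (2 * p') / C)); last by rewrite divr_gt0// powR_gt0.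
have -> : C * rho `^ (- b) * (rho `^ (2 * p') / C) = rho `^ del.
  rewrite /del addrC powRD; last by rewrite (gt_eqF rho0) implybT.
  by field; rewrite gt_eqF.
have -> : 2 * (Ax `^ p' * rho `^ (- (2 * p'))) * D0 * (rho `^ (2 * p') / C) = D1.
  rewrite powRN /D1; field; rewrite !gt_eqF ?powR_gt0//.
apply: (@lt_le_trans _ _ (D1 + 1)); first by rewrite ltrDl.
have -> : D1 + 1 = ((D1 + 1) `^ del^-1) `^ del.
  by rewrite -powRrM mulVf ?gt_eqF// powRr1// ltW// ltr_wpDl// ltW.
apply: ge0_ler_powR; rewrite ?nnegrE ?powR_ge0 ?(ltW del0) ?(ltW rho0)//.
by rewrite le_max lexx orbT.
Qed.

End no_weak_solution.

(** * Integration by parts on [Q] *)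

Section divergence_Q.
Context {R : realType} {N : nat}.
Local Notation spacetime := (R * 'rV[R]_N)%type.
Local Notation mspacetime := (measurableTypeR R * 'rV[R]_N)%type.
Implicit Types (f phi : spacetime -> R) (z e : spacetime) (K : set spacetime).

Lemma compact_coord_bound K : compact K -> exists M : R,
  (forall z, M < `|z.1| -> ~ K z) /\ (forall z (i : 'I_N), M < `|z.2 ord0 i| -> ~ K z).
Proof.
move=> cK.
have [G1 G10 H1] := compact_continuous_bound cK (Ck_continuous (@Ck_fst _ _ 0)).
have [G2 G20 H2] := compact_continuous_bound cK (Ck_continuous (@Ck_sqnorm _ _ 0)).
(* From x_i^2 <= G2 follows |x_i| <= G2 + 1, which avoids a square root. *)
exists (G1 + G2 + 1); split => z => [|i] + Kz.
  by have := H1 _ Kz => /=; lra.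
have := H2 _ Kz; rewrite ger0_norm ?sqnorm_ge0// => h.
have : z.2 ord0 i ^+ 2 <= G2.
  by apply: le_trans h; rewrite /sqnorm (bigD1 i)//= lerDl sumr_ge0// => j _;
    exact: sqr_ge0.
rewrite -real_normK ?num_real//; have := normr_ge0 (z.2 ord0 i).
by move: `|_| => y; nra.
Qed.

Lemma derive_vanish K f e z : closed K -> (forall z, ~ K z -> f z = 0) ->
  ~ K z -> 'D_e f z = 0.
Proof.
move=> clK f0 Kz; rewrite (@near_eq_derive _ _ _ _ (cst 0)) ?derive_cst//.
have : nbhs z (~` K) by apply: open_nbhs_nbhs; split => //; exact: closed_openC.
by apply: filterS => y /f0.
Qed.

Lemma compact_support_integrable K f : compact K -> continuous f ->
  (forall z, ~ K z -> f z = 0) ->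
  lebesgue_tx.-integrable [set: mspacetime] (EFin \o f).
Proof.
move=> cK cf f0; have [M [M1 M2]] := compact_coord_bound cK.
have [B _ HB] := compact_continuous_bound cK cf.
apply: (@bounded_support_integrable _ _ _ M `|B|).
- exact: continuous_measurable_tx.
- move=> z; have [Kz|/f0 ->] := pselect (K z); last by rewrite normr0.
  by apply: le_trans (HB _ Kz) _; exact: ler_norm.
- by move=> z /M1/f0.
- by move=> z i /M2/f0.
Qed.

(** The support of [F] is a compact subset of the open half-space, so the integral over [Q] is the
    integral over all of spacetime and there is no boundary term at t = 0. *)
Lemma Rintegral_derive_Q K e (F G : spacetime -> R) :
  e = et \/ (exists i, e = ex i) -> compact K -> K `<=` Q ->
  (forall z, is_derive z e F (G z)) -> continuous G ->
  (forall z, ~ K z -> F z = 0) ->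
  lebesgue_tx.-integrable (Q : set mspacetime) (EFin \o G) /\
  \int[lebesgue_tx]_(z in Q) G z = 0.
Proof.
move=> He cK KQ FG cG F0.
have clK : closed K by apply: compact_closed cK; exact: norm_hausdorff.
have G0 z : ~ K z -> G z = 0.
  by move=> Kz; have [_ <-] := FG z; exact: derive_vanish Kz.
have [M [M1 M2]] := compact_coord_bound cK.
have [B _ HB] := compact_continuous_bound cK cG.
have iG := compact_support_integrable cK cG G0.
split; first by apply: integrableS iG => //; exact: measurable_Q.
rewrite Rintegral_mkcond.
have -> : G \_ Q = G.
  by apply/funext => z; rewrite patchE; case: ifPn => // /negP zQ;
    rewrite G0// => /KQ ?; apply: zQ; exact/mem_set.
rewrite /Rintegral (@integral_derive_tx _ _ e F G M `|B|)//.
- move=> z; have [Kz|/G0 ->] := pselect (K z); last by rewrite normr0.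
  by apply: le_trans (HB _ Kz) _; exact: ler_norm.
- by move=> z /M1 Kz; split; [exact: F0|exact: G0].
- by move=> z i /M2 Kz; split; [exact: F0|exact: G0].
Qed.

Lemma Ck_dt m j phi : Ck (m + j) phi -> Ck m (dt j phi).
Proof.
elim: j m => [|j IH] m; first by rewrite addn0.
rewrite addnS -addSn => /IH [_ H].
by have [] := H et (or_introl erefl).
Qed.

Lemma dt_vanish K j phi : closed K -> (forall z, ~ K z -> phi z = 0) ->
  forall z, ~ K z -> dt j phi z = 0.
Proof. by move=> clK phi0; elim: j => //= j IH z; exact: derive_vanish. Qed.

End divergence_Q.

(** * Stationary classical solutions are weak solutions *)

Section stationary.
Context {R : realType} {N : nat}.
Local Notation spacetime := (R * 'rV[R]_N)%type.
Local Notation mspacetime := (measurableTypeR R * 'rV[R]_N)%type.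

Lemma continuous_radial (f : R -> R) :
  (forall s, 0 <= s -> {for s, continuous f}) ->
  continuous (fun z : spacetime => f (sqnorm z)).
Proof.
move=> cf z; apply: (@continuous_comp _ _ _ (@sqnorm R N) f).
  exact: (Ck_continuous (@Ck_sqnorm _ _ 0)).
exact/cf/sqnorm_ge0.
Qed.

Lemma derivable_continuous_R (f : R -> R) (s df : R) :
  is_derive s 1 f df -> {for s, continuous f}.
Proof. by move=> [df' _]; apply/differentiable_continuous/derivable1_diffP. Qed.

Variables (p q : R) (h h1 h2 : R -> R) (w : spacetime -> R).
Hypotheses (p0 : 0 <= p) (q0 : q != 0).
Hypothesis hD : forall s : R, 0 <= s -> is_derive s 1 h (h1 s).
Hypothesis h1D : forall s : R, 0 <= s -> is_derive s 1 h1 (h2 s).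
Hypothesis ch2 : forall s : R, 0 <= s -> {for s, continuous h2}.
Let u (z : spacetime) := h (sqnorm z).
Hypothesis wE : forall z, `|u z| `^ p + w z =
  - (4 * sqnorm z * h2 (sqnorm z) + 2 * N%:R * h1 (sqnorm z)).

Let cu : continuous u.
Proof. by apply: continuous_radial => s /hD /derivable_continuous_R. Qed.

Let uE : u = fun z => h (sqnorm z) * cst 1 z.1.
Proof. by apply/funext => z; rewrite mulr1. Qed.

Let ui i (z : spacetime) : R := 2 * z.2 ord0 i * h1 (sqnorm z).
Let uii i (z : spacetime) : R := 4 * z.2 ord0 i ^+ 2 * h2 (sqnorm z) + 2 * h1 (sqnorm z).

Let uD i z : is_derive z (ex i) u (ui i z).
Proof.
rewrite uE; apply: is_derive_eq.
  exact: (is_derive_radial_ex (cst 1) hD).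
by rewrite mulr1.
Qed.

Let uiD i z : is_derive z (ex i) (ui i) (uii i z).
Proof.
rewrite (_ : ui i = fun z => 'D_(ex i) (fun z => h (sqnorm z) * cst 1 z.1) z).
  apply: is_derive_eq; first exact: (is_derive2_radial_ex (cst 1) hD h1D).
  by rewrite mulr1.
by apply/funext => z'; rewrite -uE; have [_ ->] := uD i z'.
Qed.

Let cuii i : continuous (uii i).
Proof.
have c2 := continuous_radial ch2.
have c1 : continuous (fun z : spacetime => h1 (sqnorm z)).
  by apply: continuous_radial => s /h1D /derivable_continuous_R.
have cc : continuous (fun z : spacetime => z.2 ord0 i) by exact: continuous_coord.
move=> z; apply: cvgD; last by apply: cvgM; [exact: cvg_cst|exact: c1].
apply: cvgM; last exact: c2.
apply: cvgM; first exact: cvg_cst.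
by apply: cvgM; exact: cc.
Qed.

Let uDt z : is_derive z et u 0.
Proof.
have D := is_derive_comp1 (is_derive_sqnorm_et z) (hD (sqnorm_ge0 z)).
by apply: is_derive_eq; rewrite mulr0.
Qed.

Let mQ := @measurable_Q R N.

Let Lloc_u : Lloc p u.
Proof.
split.
  by apply: measurable_funTS; exact: continuous_measurable_tx.
move=> K cK KQ; have mK := compact_measurable_tx cK.
have Koo : (lebesgue_tx K < +oo)%E.
  have [M [M1 M2]] := compact_coord_bound cK; pose m := `|M|.
  have Mm : M <= m by exact: ler_norm.
  have m0 : 0 <= m by exact: normr_ge0.
  apply: (@le_lt_trans _ _ (lebesgue_tx (`[- m, m]%classic `*`
      box (const_mx (- m)) (const_mx m) : set mspacetime))); last first.
    rewrite lebesgue_tx_box ?ltry//; first lra.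
    by move=> i; rewrite !mxE; lra.
  apply: le_measure; rewrite ?inE//.
    by apply: measurableX; [exact: measurable_itv|exact: measurable_box].
  move=> z Kz; split => /=.
    rewrite in_itv/= -ler_norml leNgt; apply/negP => mz; apply: M1 Kz.
    exact: le_lt_trans mz.
  move=> i; rewrite !mxE in_itv/= -ler_norml leNgt; apply/negP => mz.
  by apply: (M2 _ i) Kz; exact: le_lt_trans mz.
have [G G0 HG] := compact_continuous_bound cK cu.
apply: (integrable_lty mK); apply: measurable_bounded_integrable => //.
  apply: measurable_funTS; apply: (measurableT_comp (@measurable_powR R p)).
  by apply: measurableT_comp => //; exact: continuous_measurable_tx.
exists (G `^ p); split => // x /ltW Gx z Kz /=; apply: le_trans Gx.
rewrite ger0_norm ?powR_ge0//.
by apply: ge0_ler_powR; rewrite ?nnegrE//; exact: HG.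
Qed.

(** As [u] is constant in time, the integrand is the time derivative of [u * psi]. *)
Let dt_u (psi : spacetime -> R) K : compact K -> K `<=` Q -> Ck 1 psi ->
  (forall z, ~ K z -> psi z = 0) ->
  \int[lebesgue_tx]_(z in Q) (u z * 'D_et psi z) = 0.
Proof.
move=> cK KQ [cpsi H] psi0; have [dpsi [cdpsi _]] := H et (or_introl erefl).
apply: (@Rintegral_derive_Q _ _ K et (u * psi) _ (or_introl erefl) cK KQ _ _ _).2.
- move=> z; have D1 := uDt z; have D2 := derivableP (dpsi z).
  by apply: is_derive_eq; rewrite scaler0 addr0.
- by move=> z; apply: cvgM; [exact: cu|exact: cdpsi].
- by move=> z /psi0; rewrite fctE => ->; rewrite mulr0.
Qed.

Let Rintegral0_Q : \int[lebesgue_tx]_(z in (Q : set mspacetime)) (0 : R) = 0.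
Proof. by rewrite /Rintegral integral0. Qed.

Lemma stationary_weak_solution k : (2 <= k)%N -> weak_solution k p q w u (cst 0).
Proof.
move=> k2; split; first exact: Lloc_u.
- split; first exact: measurable_cst.
  move=> K _ _; under eq_integral do rewrite normr0 powR0//.
  by rewrite integral0.
- move=> phi [Cphi [K [cK KQ phi0]]].
  have clK : closed K by apply: compact_closed cK; exact: norm_hausdorff.
  under eq_Rintegral do rewrite mul0r.
  (* Because k - 1 >= 1, the outermost time derivative on [phi] can be split off for [dt_u]. *)
  rewrite Rintegral0_Q; case: k k2 => [//|[//|k _]] /=.
  rewrite (@dt_u (dt k phi) K) ?mulr0//; first exact: Ck_dt.
  exact: dt_vanish.
move=> phi [Cphi [K [cK KQ phi0]]].
have clK : closed K by apply: compact_closed cK; exact: norm_hausdorff.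
under [X in _ = - X - _]eq_Rintegral do rewrite mul0r.
rewrite Rintegral0_Q oppr0 add0r.
pose lap_u (z : spacetime) := \sum_(i < N) uii i z.
have lap_uE z : lap_u z = 4 * sqnorm z * h2 (sqnorm z) + 2 * N%:R * h1 (sqnorm z).
  rewrite /lap_u big_split /= sumr_const card_ord -mulr_suml -mulr_sumr.
  by rewrite -[_ *+ N]mulr_natr -/(sqnorm z); ring.
have clap : continuous (laplacian phi) by exact: Cc2_continuous_laplacian.
have cphi : continuous phi by exact: Ck_continuous Cphi.
have clap_u : continuous lap_u.
  rewrite (_ : lap_u = \sum_(i < N) uii i); last first.
    by apply/funext => z; rewrite fct_sumE.
  elim/big_ind : _ => //; first exact: cst_continuous.
  by move=> f1 f2 c1 c2 z; apply: cvgD; [exact: c1|exact: c2].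
have lap_phi0 z : ~ K z -> laplacian phi z = 0.
  move=> Kz; rewrite /laplacian big1// => i _.
  by apply: derive_vanish Kz => // z' Kz'; exact: derive_vanish Kz'.
have i1 : lebesgue_tx.-integrable (Q : set mspacetime)
    (EFin \o (fun z => u z * laplacian phi z)).
  apply: (@integrableS _ _ _ _ setT) => //.
  apply: (compact_support_integrable cK).
    by move=> z; apply: cvgM; [exact: cu|exact: clap].
  by move=> z /lap_phi0 ->; rewrite mulr0.
have i2 : lebesgue_tx.-integrable (Q : set mspacetime)
    (EFin \o (fun z => lap_u z * phi z)).
  apply: (@integrableS _ _ _ _ setT) => //.
  apply: (compact_support_integrable cK).
    by move=> z; apply: cvgM; [exact: clap_u|exact: cphi].
  by move=> z /phi0 ->; rewrite mulr0.
have green : \int[lebesgue_tx]_(z in Q) (u z * laplacian phi z - lap_u z * phi z) = 0.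
  (* The products of first derivatives cancel in the i-th derivative of u D_i phi - D_i u phi,
     leaving [G i]. *)
  pose G i (z : spacetime) :=
    u z * 'D_(ex i) (fun z => 'D_(ex i) phi z) z - uii i z * phi z.
  have Gi i : lebesgue_tx.-integrable (Q : set mspacetime) (EFin \o G i) /\
      \int[lebesgue_tx]_(z in Q) G i z = 0.
    have he : ex i = et :> spacetime \/ exists j, ex i = ex j :> spacetime.
    by right; exists i.
    have [_ /(_ _ he) [d1 [c1 /(_ _ he) [d2 [c2 _]]]]] := Cphi.
    apply: (@Rintegral_derive_Q _ _ K (ex i)
      (u * (fun z => 'D_(ex i) phi z) - ui i * phi) (G i) he cK KQ).
    + move=> z; have D1 := derivableP (d1 z); have D2 := derivableP (d2 z).
      have D3 := uD i z; have D4 := uiD i z.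
      by apply: is_derive_eq; rewrite /G /GRing.scale /=; ring.
    + move=> z; apply: cvgB; apply: cvgM; [exact: cu|exact: c2|exact: cuii|exact: cphi].
    + move=> z Kz; rewrite !fctE /= phi0// mulr0 subr0 (derive_vanish (ex i) clK phi0 Kz).
      by rewrite mulr0.
  have -> : (fun z => u z * laplacian phi z - lap_u z * phi z) = \sum_(i < N) G i.
    apply/funext => z; rewrite fct_sumE /G sumrB /lap_u mulr_suml /laplacian.
    by rewrite mulr_sumr.
  (* Integrability is carried through the induction because additivity of the integral asks for
     it. *)
  suff [] : lebesgue_tx.-integrable (Q : set mspacetime) (EFin \o (\sum_(i < N) G i)) /\
     \int[lebesgue_tx]_(z in Q) (\sum_(i < N) G i) z = 0 by [].
  elim/big_ind : _ => //.
    by split; [exact: integrable0|exact: Rintegral0_Q].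
  move=> f1 f2 [if1 e1] [if2 e2]; split.
    exact: eq_integrable (integrableD mQ if1 if2).
  by rewrite RintegralD// e1 e2 addr0.
rewrite RintegralB// in green.
have -> : \int[lebesgue_tx]_(z in Q) (u z * laplacian phi z) =
   \int[lebesgue_tx]_(z in Q) (lap_u z * phi z) by apply/eqP; rewrite -subr_eq0 green.
rewrite -mulN1r -RintegralZl//; apply: eq_Rintegral => z _.
by rewrite normr0 powR0// addr0 wE -lap_uE; ring.
Qed.

End stationary.

(** * The explicit stationary solution *)

Section existence.
Context {R : realType} {N : nat}.
Local Notation spacetime := (R * 'rV[R]_N)%type.

Definition shifted_pow (r s : R) : R := (1 + s) `^ r.

Lemma is_derive_shifted_pow (r s : R) : 0 <= s ->
  is_derive s 1 (shifted_pow r) (r * shifted_pow (r - 1) s).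
Proof.
move=> s0; rewrite (_ : shifted_pow r = (@powR R ^~ r) \o (cst 1 + id))//.
have D1 : is_derive s (1 : R) (cst 1 + id : R -> R) 1.
  by apply: is_derive_eq; rewrite add0r.
have D2 : is_derive ((cst 1 + id : R -> R) s) 1 (@powR R ^~ r)
    (r * shifted_pow (r - 1) s).
  by apply: is_derive1_powR; rewrite /= ltr_wpDr.
by apply: is_derive_eq; rewrite mulr1.
Qed.

Lemma is_derive_shifted_powZ (c r s : R) : 0 <= s ->
  is_derive s 1 (fun s => c * shifted_pow r s) (c * (r * shifted_pow (r - 1) s)).
Proof.
move=> s0; rewrite (_ : (fun s => _) = c \*: shifted_pow r)//.
by have D := is_derive_shifted_pow r s0; apply: is_derive_eq.
Qed.

Lemma shifted_pow_ge0 (r s : R) : 0 <= shifted_pow r s.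
Proof. exact: powR_ge0. Qed.

Lemma shifted_pow_gt0 (r s : R) : 0 <= s -> 0 < shifted_pow r s.
Proof. by move=> s0; apply: powR_gt0; rewrite ltr_wpDr. Qed.

Lemma shifted_powB1 (r s : R) : 0 <= s ->
  shifted_pow r s = (1 + s) * shifted_pow (r - 1) s.
Proof.
move=> s0; have s1 : 0 < 1 + s by rewrite ltr_wpDr.
rewrite /shifted_pow -[X in X * _](powRr1 (ltW s1)) -powRD.
  by congr (_ `^ _); ring.
by rewrite (gt_eqF s1) implybT.
Qed.

(** A time-independent function factors through the space projection, which maps [et] to 0. Its time
    derivative therefore exists and is zero, and time independence passes to every [dt j u]. *)
Lemma stationary_initial_values (k : nat) (u : spacetime -> R) :
  (forall t t' x, u (t, x) = u (t', x)) ->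
  has_initial_values u (fun (i : 'I_k) x => dt i u (0, x)).
Proof.
move=> ut.
have D (f : spacetime -> R) (z : spacetime) :
    (forall t t' x, f (t, x) = f (t', x)) -> is_derive z et f 0.
  move=> ft; case: z => t x; rewrite (_ : f = (fun y => f (0, y)) \o snd); last first.
    by apply/funext => -[t' x'] /=.
  apply: (@is_derive_affine _ _ _ _ (@snd R 'rV[R]_N) et 0); last exact: is_derive0.
  by move=> h /=; rewrite scaler0.
have dt_cst j t t' x : dt j u (t, x) = dt j u (t', x).
  elim: j t t' x => [|j IH] t t' x /=; first exact: ut.
  by have [_ ->] := D _ (t, x) IH; have [_ ->] := D _ (t', x) IH.
move=> i x; split; last first.
  rewrite (_ : (fun t => dt i u (t, x)) = cst (dt i u (0, x))); first exact: cvg_cst.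
  by apply/funext => t; exact: dt_cst.
move=> j _; apply: nearW => t.
by have [] := D _ (t, x) (dt_cst j).
Qed.

Lemma positive_global_solution_exists (k : nat) (p q a : R) :
  (2 <= k)%N -> 1 < p -> q != 0 -> 2 * p / (p - 1) <= a -> a < N%:R ->
  exists (g : 'rV[R]_N -> R) (u0 : 'I_k -> 'rV[R]_N -> R) (u : spacetime -> R),
    Ja a g /\ positive_global_solution p q (fun z => g z.2) u0 u.
Proof.
move=> k2 p1 q0 pa aN.
have p10 : 0 < p - 1 by lra.
have pa2 : 2 * p <= a * (p - 1) by rewrite -ler_pdivrMr.
(* From 2 (p - 1) < 2p <= a (p - 1). *)
have a2 : 2 < a by rewrite -(ltr_pM2r p10); lra.
pose sg := a / 2 - 1.
have sg0 : 0 < sg by rewrite /sg; lra.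
(* This is the condition [a >= astar] rewritten: the decay of u^p is at least that of -Delta u. *)
have sgp : sg + 1 <= sg * p by rewrite /sg; lra.
(* Chosen so that eps^p is eps sg (N - a), half the constant in the lower bound [lap_ge]; half of
   that bound then survives in [G]. *)
pose eps := (sg * (N%:R - a)) `^ (p - 1)^-1.
have c0 : 0 < sg * (N%:R - a) by rewrite mulr_gt0//; lra.
have eps0 : 0 < eps by exact: powR_gt0.
have epsp : eps `^ p = eps * (sg * (N%:R - a)).
  rewrite -(mulr_powRB1 (ltW eps0)); last lra.
  by congr (_ * _); rewrite /eps -powRrM mulVf ?gt_eqF// powRr1// ltW.
pose h s := eps * shifted_pow (- sg) s.
pose h1 s := eps * - sg * shifted_pow (- sg - 1) s.
pose h2 s := eps * - sg * (- sg - 1) * shifted_pow (- sg - 1 - 1) s.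
have hD (s : R) : 0 <= s -> is_derive s 1 h (h1 s).
  by move=> s0; rewrite /h1 -mulrA; exact: is_derive_shifted_powZ.
have h1D (s : R) : 0 <= s -> is_derive s 1 h1 (h2 s).
  by move=> s0; rewrite /h2 -[X in is_derive _ _ _ X]mulrA; exact: is_derive_shifted_powZ.
have h2C (s : R) : 0 <= s -> {for s, continuous h2}.
  by move=> s0; exact: derivable_continuous_R (is_derive_shifted_powZ _ _ s0).
pose u (z : spacetime) := h (sqnorm z).
pose lap s := - (4 * s * h2 s + 2 * N%:R * h1 s).
pose G s := lap s - h s `^ p.
(* The time 0 is a placeholder: [sqnorm] takes a spacetime point and ignores its time. *)
pose g (x : 'rV[R]_N) := G (sqnorm (0 : R, x)).
have h0 s : 0 <= s -> 0 < h s.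
  by move=> s0; rewrite mulr_gt0// shifted_pow_gt0.
(* Here 2 (sg + 1) = a. The last factor lies between (N - a)(1 + s) and N (1 + s), which yields the
   next two bounds. *)
have lapE s : 0 <= s ->
    lap s = 2 * eps * sg * shifted_pow (- sg - 1 - 1) s * (N%:R + (N%:R - a) * s).
  move=> s0; rewrite /lap /h1 /h2.
  by rewrite (shifted_powB1 (- sg - 1) s0) /sg; field.
have lap_ge s : 0 <= s ->
    2 * eps * sg * (N%:R - a) * shifted_pow (- sg - 1) s <= lap s.
  move=> s0; rewrite (lapE _ s0) (shifted_powB1 (- sg - 1) s0) -subr_ge0.
  rewrite (_ : _ - _ = 2 * eps * sg * shifted_pow (- sg - 1 - 1) s * a); last by ring.
  by rewrite !mulr_ge0 ?shifted_pow_ge0 ?(ltW eps0) ?(ltW sg0)//; lra.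
have lap_le s : 0 <= s ->
    lap s <= 2 * eps * sg * N%:R * shifted_pow (- sg - 1) s.
  move=> s0; rewrite (lapE _ s0) (shifted_powB1 (- sg - 1) s0) -subr_ge0.
  rewrite (_ : _ - _ = 2 * eps * sg * shifted_pow (- sg - 1 - 1) s * a * s); last by ring.
  by rewrite !mulr_ge0 ?shifted_pow_ge0 ?(ltW eps0) ?(ltW sg0)//; lra.
have hp_le s : 0 <= s ->
    h s `^ p <= eps * sg * (N%:R - a) * shifted_pow (- sg - 1) s.
  move=> s0; have s1 : 1 <= 1 + s by rewrite lerDl.
  rewrite powRM ?shifted_pow_ge0 ?(ltW eps0)// epsp mulrA ler_wpM2l//.
    by rewrite -mulrA mulr_ge0 ?(ltW eps0) ?(ltW c0).
  by rewrite -powRrM ler_powR//; lra.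
have G0 s : 0 <= s -> 0 < G s.
  move=> s0; rewrite subr_gt0; apply: le_lt_trans (hp_le _ s0) _.
  apply: lt_le_trans (lap_ge _ s0); rewrite -subr_gt0.
  rewrite (_ : _ - _ = eps * (sg * (N%:R - a)) * shifted_pow (- sg - 1) s); last by ring.
  by rewrite mulr_gt0 ?shifted_pow_gt0// mulr_gt0.
have GC (s : R) : 0 <= s -> {for s, continuous G}.
  move=> s0; have hs := derivable_continuous_R (hD _ s0).
  apply: cvgB.
    apply: cvgN; apply: cvgD; apply: cvgM.
    - by apply: cvgM; [exact: cvg_cst|exact: cvg_id].
    - exact: h2C.
    - exact: cvg_cst.
    - exact: derivable_continuous_R (h1D _ s0).
  apply: (@continuous_comp _ _ _ h (@powR R ^~ p)); first exact: hs.
  exact: derivable_continuous_R (is_derive1_powR p (h0 _ s0)).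
exists g, (fun i x => dt i u (0, x)), u; split; last first.
  split; first exists (cst 0).
  - apply: (@stationary_weak_solution _ _ p q h h1 h2) => //; first lra.
    move=> z; rewrite ger0_norm ?(ltW (h0 _ (sqnorm_ge0 z)))//.
    by rewrite /g /G addrC subrK.
  - by move=> z _; exact/h0/sqnorm_ge0.
  - exact: stationary_initial_values.
split.
- move=> x; apply: (@continuous_comp _ _ _ (fun x => (0 : R, x)) (fun z => G (sqnorm z))).
    apply: (@continuous_pair _ _ _ (fun=> 0 : R) id).
      exact: cst_continuous.
    exact: cvg_id.
  exact: (continuous_radial GC).
- by move=> x; exact/G0/sqnorm_ge0.
(* The constant is that of [lap_le], and (1 + |x|^2)^(-a/2) <= |x|^-a. The threshold 1 keeps |x|
   positive. *)
exists (2 * eps * sg * N%:R), 1; split.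
  by rewrite !mulr_gt0// (lt_trans _ aN)//; lra.
move=> x x1; set s := sqnorm (0 : R, x).
have s0 : 0 <= s by exact: sqnorm_ge0.
apply: (@le_trans _ _ (lap s)); first by rewrite gerBl powR_ge0.
apply: le_trans (lap_le _ s0) _; rewrite ler_wpM2l//.
  by rewrite !mulr_ge0 ?(ltW eps0) ?(ltW sg0).
have e0 : 0 < enorm x by exact: lt_le_trans x1.
have -> : - sg - 1 = - (a / 2) by rewrite /sg; ring.
rewrite /shifted_pow !powRN lef_pV2 ?posrE ?powR_gt0//; last by rewrite ltr_wpDr.
rewrite (_ : enorm x `^ a = s `^ (a / 2)); last first.
  rewrite [X in _ `^ X](_ : a = 2 * (a / 2)); last by field.
  by rewrite powRrM powR_mulrn ?(ltW e0)// sqr_sqrtr.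
by apply: ge0_ler_powR; rewrite ?nnegrE -/s; lra.
Qed.

End existence.

Theorem theorem1p8 (R : realType) (k N : nat) (p q : R)
    (hk : (2 <= k)%N) (hN : (3 <= N)%N)
    (hq : 1 < q) (hp : N%:R / (N%:R - 2) < p) :
  let astar := 2 * p / (p - 1) in
  (forall (a : R) (g : 'rV[R]_N -> R), a < astar -> Ia a g ->
     ~ exists u v : R * 'rV[R]_N -> R,
         weak_solution k p q (fun z => g z.2) u v) /\
  (forall a : R, astar <= a -> a < N%:R ->
     exists (g : 'rV[R]_N -> R) (u0 : 'I_k -> 'rV[R]_N -> R)
            (u : R * 'rV[R]_N -> R),
       Ja a g /\ positive_global_solution p q (fun z => g z.2) u0 u).
Proof.
have N3 : 3 <= N%:R :> R by rewrite (ler_nat R 3).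
have p1 : 1 < p.
  apply: lt_trans hp; rewrite ltr_pdivlMr; last by rewrite subr_gt0; lra.
  by rewrite mul1r; lra.
split => [a g|a].
  by apply: no_weak_solution => //; exact: leq_trans hN.
by apply: positive_global_solution_exists => //; rewrite gt_eqF//; lra.
Qed.
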